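(* Let $t\in[0,1)$ and $\gamma>0$. (i) $[V_{g_t},A^{-\gamma}]=[C_t,A^{-\gamma}]=A^{-(\gamma+1)}$ and $[V_{g_t},A^{-\gamma}_0]=[C_t,A^{-\gamma}_0]=A^{-(\gamma+1)}_0$ as Banach spaces. (ii) $A^{-\gamma}$ is a proper subspace of $[C_t,A^{-\gamma}_0]=A^{-(\gamma+1)}_0$.
   Context: $\mathbb{D}=\{z\in\mathbb{C}:|z|<1\}$; $H(\mathbb{D})$ is the Fréchet space of all analytic functions on $\mathbb{D}$ with the topology of uniform convergence on compact sets. For $\gamma>0$ the Korenblum growth spaces are $A^{-\gamma}:=\{f\in H(\mathbb{D}):\sup_{z\in\mathbb{D}}(1-|z|)^\gamma|f(z)|<\infty\}$ and $A^{-\gamma}_0:=\{f\in H(\mathbb{D}):\lim_{|z|\to1^-}(1-|z|)^\gamma|f(z)|=0\}$, both with norm $\sup_{z\in\mathbb{D}}(1-|z|)^\gamma|f(z)|$. For $t\in(0,1]$ let $g_t(z):=-\frac{\mathrm{Log}(1-tz)}{t}$ and let $g_0(z):=z$, for $z\in\mathbb{D}$. Thus $(V_{g_t}f)(z)=\int_0^z\frac{f(\xi)}{1-t\xi}\,d\xi$, and the generalized Cesàro operator $C_t$ is $(C_tf)(z):=\frac1z\int_0^z\frac{f(\xi)}{1-t\xi}\,d\xi$ for $z\in\mathbb{D}\setminus\{0\}$, $(C_tf)(0):=f(0)$, for $f\in H(\mathbb{D})$. For $X$ a Banach space continuously included in $H(\mathbb{D})$ and $T\colon H(\mathbb{D})\to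 H(\mathbb{D})$ continuous linear with $T(X)\subseteq X$, the optimal domain is $[T,X]:=\{f\in H(\mathbb{D}):Tf\in X\}$ with (semi-)norm $\|f\|_{[T,X]}:=\|Tf\|_X$. Equality ''as Banach spaces'' means equality as linear subspaces of $H(\mathbb{D})$ with equivalent complete norms. *)

(* Defs.v *)
From Stdlib Require Import Reals.
From Coquelicot Require Import Coquelicot.
Open Scope R_scope.

Definition in_disk (z : C) : Prop := Cmod z < 1.

(** Functions on the open unit disk are represented by total functions [C -> C]
    whose values off the disk are irrelevant: every notion below depends only on
    the restriction to the disk, and functions are identified by [eq_on_disk]. *)
Definition eq_on_disk (f g : C -> C) : Prop :=
  forall z : C, in_disk z -> f z = g z.

(** Membership in H(D): complex differentiability at each point of the disk. *)
Definition analytic_on_disk (f : C -> C) : Prop :=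
  forall z : C, in_disk z -> ex_derive (K := C_AbsRing) (V := C_NormedModule) f z.

Definition fzero : C -> C := fun _ => RtoC 0.
Definition fadd (f g : C -> C) : C -> C := fun z => Cplus (f z) (g z).
Definition fsub (f g : C -> C) : C -> C := fun z => Cminus (f z) (g z).
Definition fscal (a : C) (f : C -> C) : C -> C := fun z => Cmult a (f z).

(** A set of functions with a real-valued functional on it.  The linear and norm
    axioms are not part of the structure; they are stated by [is_banach]. *)
Record fspace := FSpace {
  carrier :> (C -> C) -> Prop ;
  fnorm : (C -> C) -> R
}.

Definition is_linear_subspace (X : fspace) : Prop :=
  (forall f, X f -> analytic_on_disk f) /\
  (forall f g, eq_on_disk f g -> X f -> X g) /\
  X fzero /\
  (forall f g, X f -> X g -> X (fadd f g)) /\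
  (forall a f, X f -> X (fscal a f)).

Definition is_norm (X : fspace) : Prop :=
  (forall f, X f -> 0 <= fnorm X f) /\
  (forall f, X f -> (fnorm X f = 0 <-> eq_on_disk f fzero)) /\
  (forall a f, X f -> fnorm X (fscal a f) = Cmod a * fnorm X f) /\
  (forall f g, X f -> X g -> fnorm X (fadd f g) <= fnorm X f + fnorm X g).

Definition is_complete (X : fspace) : Prop :=
  forall u : nat -> C -> C,
    (forall n, X (u n)) ->
    (forall eps : R, 0 < eps -> exists N : nat, forall m n : nat,
       (N <= m)%nat -> (N <= n)%nat -> fnorm X (fsub (u m) (u n)) < eps) ->
    exists f : C -> C,
      X f /\ is_lim_seq (fun n => fnorm X (fsub (u n) f)) 0.

Definition is_banach (X : fspace) : Prop :=
  is_linear_subspace X /\ is_norm X /\ is_complete X.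

(** Equality as Banach spaces: the same linear subspace of H(D), with
    equivalent complete norms. *)
Definition banach_eq (X Y : fspace) : Prop :=
  is_banach X /\ is_banach Y /\
  (forall f, X f <-> Y f) /\
  (exists c K : R, 0 < c /\ 0 < K /\
     forall f, X f -> c * fnorm X f <= fnorm Y f /\ fnorm Y f <= K * fnorm X f).

Definition proper_subspace (X Y : fspace) : Prop :=
  is_linear_subspace X /\ is_linear_subspace Y /\
  (forall f, X f -> Y f) /\ (exists f, Y f /\ ~ X f).

Definition growth_weight (gamma : R) (f : C -> C) (z : C) : R :=
  Rpower (1 - Cmod z) gamma * Cmod (f z).

Definition growth_norm (gamma : R) (f : C -> C) : R :=
  real (Lub_Rbar (fun x => exists z : C, in_disk z /\ x = growth_weight gamma f z)).

Definition A (gamma : R) : fspace := {|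
  carrier := fun f => analytic_on_disk f /\
    exists M : R, forall z : C, in_disk z -> growth_weight gamma f z <= M ;
  fnorm := growth_norm gamma
|}.

Definition A0 (gamma : R) : fspace := {|
  carrier := fun f => analytic_on_disk f /\
    forall eps : R, 0 < eps -> exists delta : R, 0 < delta /\
      forall z : C, 1 - delta < Cmod z < 1 -> growth_weight gamma f z < eps ;
  fnorm := growth_norm gamma
|}.

(** [||.||_{T,X}] is a priori only a seminorm. *)
Definition optimal_domain (T : (C -> C) -> C -> C) (X : fspace) : fspace := {|
  carrier := fun f => analytic_on_disk f /\ X (T f) ;
  fnorm := fun f => fnorm X (T f)
|}.

(** Principal argument, with values in (-PI, PI]; the value at 0 is junk. *)
Definition Carg (z : C) : R :=
  if Rlt_dec 0 (Re z) then atan (Im z / Re z)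
  else if Rlt_dec 0 (Im z) then PI / 2 - atan (Re z / Im z)
  else if Rlt_dec (Im z) 0 then - (PI / 2) - atan (Re z / Im z)
  else PI.

Definition CLog (z : C) : C := (ln (Cmod z), Carg z).

(** Contour integral along the straight segment from 0 to [z]. *)
Definition CInt0 (h : C -> C) (z : C) : C :=
  Cmult z (RInt (V := C_R_CompleteNormedModule)
             (fun s : R => h (Cmult (RtoC s) z)) 0 1).

(** The Volterra operator: the integral of [f * g'] from 0 to [z].  [C_derive] takes the
    limit of the difference quotient along the real direction, so it is the
    complex derivative wherever [g] is complex differentiable. *)
Definition V (g : C -> C) (f : C -> C) : C -> C :=
  CInt0 (fun xi => Cmult (f xi) (C_derive g xi)).

Definition g_ (t : R) (z : C) : C :=
  if Req_dec_T t 0 then z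
  else Copp (Cdiv (CLog (Cminus (RtoC 1) (Cmult (RtoC t) z))) (RtoC t)).

Definition Ces (t : R) (f : C -> C) (z : C) : C :=
  if Ceq_dec z (RtoC 0) then f (RtoC 0)
  else Cmult (Cdiv (RtoC 1) z)
         (CInt0 (fun xi =>
            Cdiv (f xi) (Cminus (RtoC 1) (Cmult (RtoC t) xi))) z).

(* Main.v *)
Require Import Defs.
From Stdlib Require Import Reals Lra Lia Psatz Classical ClassicalEpsilon.
From Coquelicot Require Import Coquelicot.
Open Scope R_scope.

(** Put [k xi = f xi / (1 - t xi)], which is comparable with [f] on the disk because
    [1 - t <= |1 - t xi| <= 2].  Then [Ces t f] is the mean [Phi z] of [k] over the segment
    [[0, z]] and [V (g_ t) f z = z Phi z] is the primitive of [k].  Bounds on these functions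
    close up into a cycle: [|z Phi z| <= |Phi z|]; integrating [(1 - s |z|) ^ (- gamma - 1)]
    bounds the norm of [Phi] of order [gamma] by that of [k] of order [gamma + 1]; and Cauchy's
    bound for the derivative [k] of [z Phi z] on the disk of radius [(1 - |z|) / 2] leads
    back.  Cauchy's bound also makes the growth spaces complete, through the analyticity of
    locally uniform limits.  It is derived from Goursat's bisection argument for rectangles in
    the logarithmic coordinate, where circles become vertical segments.  For (ii), the witness
    is [(1 - z) ^ (- gamma - 1 / 2)]. *)

(** * Complex derivatives and integrals along paths *)

(** Membership in H(D) is bare complex differentiability, so continuity of the derivative has to be
    earned: Cauchy's bound, applied to a difference of two translates of [f], makes [f'] locally
    Lipschitz, and the resulting quadratic Taylor remainder is what allows differentiation under the
    integral and passage to limits. Its constant depends on [f] only through a bound of [|f|]. The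
    little-o spaces ask for more than norm inequalities, so both estimates between [f] and its image
    are proved at a single point [z]. The upper one admits an additive constant [B] in the bound for
    [f], which absorbs a compact disk where nothing is small; its contribution carries the factor
    [(1 - |z|) ^ gamma] and dies at the boundary. The lower one uses the image only on a disk about
    [z] that moves to the boundary with [z]. The same constants then serve the big-O and the
    little-o spaces. Completeness of an optimal domain is never attacked directly: the two-sided
    norm inequality carries it over from the growth space of order [gamma + 1]. *)

Definition cder (f : C -> C) (z d : C) : Prop :=
  is_derive (K := C_AbsRing) (V := C_NormedModule) f z d.

Lemma cder_eps f z d : cder f z d <->
  forall eps, 0 < eps -> exists delta, 0 < delta /\ forall w, Cmod (w - z) < delta ->
    Cmod (f w - f z - d * (w - z)) <= eps * Cmod (w - z).
Proof.
split.
- intros [_ H] eps Heps.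
  destruct (H z (fun P HP => HP) (mkposreal eps Heps)) as [delta Hd].
  exists delta. split. apply cond_pos.
  intros w Hw. specialize (Hd w Hw).
  rewrite (Cmult_comm d). exact Hd.
- intros H. split.
  + apply (is_linear_scal_l (K := C_AbsRing) (V := C_NormedModule)).
  + intros x Hx eps.
    assert (E := is_filter_lim_locally_unique (V := AbsRing_NormedModule C_AbsRing) _ _ Hx).
    rewrite <- E. 
    destruct (H eps (cond_pos eps)) as [delta [d0 Hd]].
    exists (mkposreal delta d0). intros w Hw. specialize (Hd w Hw).
    rewrite (Cmult_comm d) in Hd. exact Hd.
Qed.

(** [C] carries two normed module structures over itself. The product rule, and the inner function
    of the chain rule, use the one derived from the absolute ring; the remainder estimates are
    convertible and only the linearity of the differential is proved again. *)
Lemma cder_abs f z d : cder f z d <-> is_derive (K := C_AbsRing) (V := AbsRing_NormedModule C_AbsRing) f z d.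
Proof. split; intros [H1 H2]; split; [| exact H2| | exact H2].
apply (is_linear_scal_l (K := C_AbsRing) (V := AbsRing_NormedModule C_AbsRing)).
apply (is_linear_scal_l (K := C_AbsRing) (V := C_NormedModule)).
Qed.

Lemma cder_mult f g z df dg : cder f z df -> cder g z dg ->
  cder (fun w => f w * g w)%C z (df * g z + f z * dg)%C.
Proof.
rewrite !cder_abs.
intros Hf Hg.
exact (is_derive_mult (K := C_AbsRing) f g z df dg Hf Hg Cmult_comm).
Qed.

Lemma cder_comp f g z df dg : cder f (g z) df -> cder g z dg ->
  cder (fun w => f (g w)) z (df * dg)%C.
Proof.
rewrite (cder_abs g). intros Hf Hg. rewrite Cmult_comm.
exact (is_derive_comp (K := C_AbsRing) (V := C_NormedModule) f g z df dg Hf Hg).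
Qed.

Lemma cder_plus f g z df dg : cder f z df -> cder g z dg ->
  cder (fun w => f w + g w)%C z (df + dg)%C.
Proof. intros Hf Hg. exact (is_derive_plus (K := C_AbsRing) f g z df dg Hf Hg). Qed.

Lemma cder_minus f g z df dg : cder f z df -> cder g z dg ->
  cder (fun w => f w - g w)%C z (df - dg)%C.
Proof. intros Hf Hg. exact (is_derive_minus (K := C_AbsRing) f g z df dg Hf Hg). Qed.

Lemma cder_const c z : cder (fun _ => c) z (RtoC 0).
Proof. exact (is_derive_const (K := C_AbsRing) (V := C_NormedModule) c z). Qed.

Lemma cder_id z : cder (fun w => w) z (RtoC 1).
Proof. apply cder_abs. exact (is_derive_id (K := C_AbsRing) z). Qed.

Lemma cder_ext_near f g z d r : 0 < r -> (forall w, Cmod (w - z) < r -> f w = g w) ->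
  cder f z d -> cder g z d.
Proof.
intros Hr H. apply (is_derive_ext_loc (K := C_AbsRing) (V := C_NormedModule)).
exists (mkposreal r Hr). intros y Hy. apply H, Hy.
Qed.

Definition RIntC (h : R -> C) (a b : R) : C := RInt (V := C_R_CompleteNormedModule) h a b.
Definition ex_RIntC (h : R -> C) (a b : R) : Prop := ex_RInt (V := C_R_NormedModule) h a b.

Lemma norm_Cmod (z : C) : norm (V := C_R_NormedModule) z = Cmod z.
Proof.
unfold norm; simpl. unfold prod_norm, Cmod. unfold norm; simpl.
f_equal. unfold abs; simpl. rewrite !Rmult_1_r, <- !Rabs_mult.
rewrite !Rabs_pos_eq by nra. reflexivity.
Qed.

Definition pcont (h : R -> C) (s : R) : Prop :=
  forall eps, 0 < eps -> exists delta, 0 < delta /\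
    forall s', Rabs (s' - s) < delta -> Cmod (h s' - h s) < eps.

Lemma pcont_continuous h s : pcont h s -> continuous (U := C_R_NormedModule) h s.
Proof.
intros H P [eps HP]. destruct (H eps (cond_pos eps)) as [d [d0 Hd]].
exists (mkposreal d d0). intros s' Hs'. apply HP.
apply C_NormedModule_mixin_compat1. apply Hd, Hs'.
Qed.

Lemma continuous_pcont h s : continuous (U := C_R_NormedModule) h s -> pcont h s.
Proof.
intros H eps He.
(* A ball of the product structure lies in a disk whose radius is larger by the factor [sqrt 2]. *)
assert (He' : 0 < eps / sqrt 2) by (apply Rdiv_lt_0_compat; [lra | apply Rlt_sqrt2_0]).
destruct (H (ball (h s) (mkposreal _ He'))) as [d Hd].
  exists (mkposreal _ He'); auto.
exists d. split. apply cond_pos. intros s' Hs'. specialize (Hd s' Hs').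
apply C_NormedModule_mixin_compat2 in Hd. simpl in Hd.
replace eps with (sqrt 2 * (eps / sqrt 2)). exact Hd.
field. apply sqrt2_neq_0.
Qed.

Lemma pcont_exRInt h a b : a <= b -> (forall s, a <= s <= b -> pcont h s) -> ex_RIntC h a b.
Proof.
intros Hab H. apply (ex_RInt_continuous (V := C_R_CompleteNormedModule)).
intros s. rewrite Rmin_left, Rmax_right by easy. intros Hs. apply pcont_continuous, H, Hs.
Qed.

Lemma cder_pcont f d h s : cder f (h s) d -> pcont h s -> pcont (fun s => f (h s)) s.
Proof.
intros Hf Hh eps He. destruct (proj1 (cder_eps _ _ _) Hf 1 Rlt_0_1) as [dl [dl0 Hdl]].
assert (Hm := Cmod_ge_0 d).
assert (He' : 0 < Rmin dl (eps / (1 + Cmod d))).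
{ apply Rmin_glb_lt; [easy | apply Rdiv_lt_0_compat; lra]. }
destruct (Hh _ He') as [de [de0 Hde]]. exists de; split; [easy|].
intros s' Hs'. specialize (Hde s' Hs').
assert (H1 := Rmin_l dl (eps / (1 + Cmod d))). assert (H2 := Rmin_r dl (eps / (1 + Cmod d))).
specialize (Hdl (h s') ltac:(lra)).
replace (f (h s') - f (h s))%C with ((f (h s') - f (h s) - d * (h s' - h s)) + d * (h s' - h s))%C by ring.
eapply Rle_lt_trans; [apply Cmod_triangle|]. rewrite Cmod_mult.
apply Rle_lt_trans with ((1 + Cmod d) * Cmod (h s' - h s)); [lra|].
replace eps with ((1 + Cmod d) * (eps / (1 + Cmod d))) by (field; lra).
apply Rmult_lt_compat_l; lra.
Qed.

Lemma RIntC_dist_const h c M a b : a <= b -> ex_RIntC h a b ->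
  (forall s, a <= s <= b -> Cmod (h s - c) <= M) ->
  Cmod (RIntC h a b - RtoC (b - a) * c) <= M * (b - a).
Proof.
intros Hab Hex H.
assert (H1 := RInt_correct (V := C_R_CompleteNormedModule) _ _ _ Hex).
assert (H2 := is_RInt_const (V := C_R_NormedModule) a b c).
assert (H3 := is_RInt_minus (V := C_R_NormedModule) _ _ _ _ _ _ H1 H2).
assert (H4 := is_RInt_const (V := R_NormedModule) a b M).
rewrite <- norm_Cmod, <- scal_R_Cmult, (Rmult_comm M).
apply (norm_RInt_le (V := C_R_NormedModule) _ _ a b _ _ Hab) with (2 := H3) (3 := H4).
intros s Hs. rewrite norm_Cmod. apply H, Hs.
Qed.

Lemma RIntC_bound h M a b : a <= b -> ex_RIntC h a b ->
  (forall s, a <= s <= b -> Cmod (h s) <= M) -> Cmod (RIntC h a b) <= M * (b - a).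
Proof.
intros Hab Hex H.
replace (RIntC h a b) with (RIntC h a b - RtoC (b - a) * RtoC 0)%C by ring.
apply RIntC_dist_const; [easy|easy|]. intros s Hs.
replace (h s - RtoC 0)%C with (h s) by ring. now apply H.
Qed.

Lemma RIntC_minus h k a b : ex_RIntC h a b -> ex_RIntC k a b ->
  RIntC (fun s => h s - k s)%C a b = (RIntC h a b - RIntC k a b)%C.
Proof.
intros H1 H2. exact (RInt_minus (V := C_R_CompleteNormedModule) h k a b H1 H2).
Qed.

Lemma RIntC_plus h k a b : ex_RIntC h a b -> ex_RIntC k a b ->
  RIntC (fun s => h s + k s)%C a b = (RIntC h a b + RIntC k a b)%C.
Proof.
intros H1 H2. exact (RInt_plus (V := C_R_CompleteNormedModule) h k a b H1 H2).
Qed.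

Lemma RIntC_Chasles h a b c : ex_RIntC h a b -> ex_RIntC h b c ->
  RIntC h a c = (RIntC h a b + RIntC h b c)%C.
Proof.
intros H1 H2. symmetry. exact (RInt_Chasles (V := C_R_CompleteNormedModule) h a b c H1 H2).
Qed.

(** The integral is taken in a real module, whose linearity covers real scalars only; a complex
    scalar mixes the two components, which are integrated separately. *)
Lemma is_RIntC_scal h c a b l : is_RInt (V := C_R_NormedModule) h a b l ->
  is_RInt (V := C_R_NormedModule) (fun s => c * h s)%C a b (c * l)%C.
Proof.
intros H. destruct c as [c1 c2], l as [l1 l2].
assert (H1 := is_RInt_fct_extend_fst _ _ _ _ H).
assert (H2 := is_RInt_fct_extend_snd _ _ _ _ H). simpl in H1, H2.
apply (is_RInt_fct_extend_pair (U := R_NormedModule) (V := R_NormedModule)); simpl.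
- apply (is_RInt_minus (V := R_NormedModule)); apply (is_RInt_scal (V := R_NormedModule)); assumption.
- apply (is_RInt_plus (V := R_NormedModule)); apply (is_RInt_scal (V := R_NormedModule)); assumption.
Qed.

Lemma RIntC_scal h c a b : ex_RIntC h a b ->
  RIntC (fun s => c * h s)%C a b = (c * RIntC h a b)%C.
Proof.
intros H. apply (is_RInt_unique (V := C_R_CompleteNormedModule)).
apply is_RIntC_scal. exact (RInt_correct (V := C_R_CompleteNormedModule) _ _ _ H).
Qed.

Lemma RIntC_ext h k a b : a <= b -> (forall s, a < s < b -> h s = k s) ->
  RIntC h a b = RIntC k a b.
Proof.
intros Hab H. refine (RInt_ext (V := C_R_CompleteNormedModule) h k a b _).
intros s. rewrite Rmin_left, Rmax_right by easy. apply H.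
Qed.

(** * Goursat's theorem for rectangles *)

Lemma nested_intervals (a b : nat -> R) :
  (forall n, a n <= a (S n)) -> (forall n, b (S n) <= b n) -> (forall n, a n <= b n) ->
  exists u, forall n, a n <= u <= b n.
Proof.
intros Ha Hb Hab.
assert (Ha' : forall n k, a n <= a (n + k)%nat).
{ intros n k. induction k. rewrite Nat.add_0_r; lra.
  rewrite Nat.add_succ_r. specialize (Ha (n + k)%nat); lra. }
assert (Hb' : forall n k, b (n + k)%nat <= b n).
{ intros n k. induction k. rewrite Nat.add_0_r; lra.
  rewrite Nat.add_succ_r. specialize (Hb (n + k)%nat); lra. }
assert (Hx : forall n m, a n <= b m).
{ intros n m. apply Rle_trans with (a (n + m)%nat). apply Ha'.
  apply Rle_trans with (b (n + m)%nat). apply Hab. rewrite Nat.add_comm. apply Hb'. }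
destruct (completeness (fun x => exists n, x = a n)) as [u [Hu1 Hu2]].
- exists (b O). intros x [n ->]. apply Hx.
- exists (a O), O. reflexivity.
- exists u. intros n. split.
  + apply Hu1. now exists n.
  + apply Hu2. intros x [m ->]. apply Hx.
Qed.

(** [P x y s] speaks of the rectangle with corner [(x, y)] and sides [p * s] and [q * s], so that
    the fixed shape leaves one size parameter. If [P] fails on a rectangle it fails on one of the
    quarters; the nested rectangles shrink to a point [(u, v)], where the local hypothesis is
    contradicted. It serves both Goursat's theorem and, as a form of compactness, local
    boundedness. *)
Lemma bisection (P : R -> R -> R -> Prop) (p q : R) : 0 < p -> 0 < q ->
  (forall x y s, 0 < s -> P x y s -> P (x + p * s) y s -> P x (y + q * s) s ->
     P (x + p * s) (y + q * s) s -> P x y (2 * s)) ->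
  (forall u v, exists d, 0 < d /\ forall x y s, 0 < s < d ->
     x <= u <= x + p * s -> y <= v <= y + q * s -> P x y s) ->
  forall x y s, 0 < s -> P x y s.
Proof.
intros Hp Hq Hsub Hloc x y s Hs. apply NNPP. intros HN.
set (dec := fun x y s => excluded_middle_informative (P x y s)).
(* Selects a quarter where [P] fails. The fourth is not tested: if the other three satisfy [P], it
   is the one that fails. *)
set (step := fun T : R * R * R => let '(x, y, s) := T in let h := s / 2 in
  if dec x y h then if dec (x + p * h) y h then if dec x (y + q * h) h
  then (x + p * h, y + q * h, h) else (x, y + q * h, h)
  else (x + p * h, y, h) else (x, y, h)).
set (T := fun n => Nat.iter n step (x, y, s)).
set (X := fun n => fst (fst (T n))). set (Y := fun n => snd (fst (T n))).
set (S' := fun n => snd (T n)).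
assert (HT : forall n, 0 < S' n /\ ~ P (X n) (Y n) (S' n) /\ S' n = s / 2 ^ n /\
  X n <= X (S n) /\ X (S n) + p * S' (S n) <= X n + p * S' n /\
  Y n <= Y (S n) /\ Y (S n) + q * S' (S n) <= Y n + q * S' n).
{ assert (HB : forall n, 0 < S' n -> ~ P (X n) (Y n) (S' n) ->
    ~ P (X (S n)) (Y (S n)) (S' (S n)) /\ S' (S n) = S' n / 2 /\
    X n <= X (S n) /\ X (S n) + p * S' (S n) <= X n + p * S' n /\
    Y n <= Y (S n) /\ Y (S n) + q * S' (S n) <= Y n + q * S' n).
  { intros n. unfold X, Y, S'. change (T (S n)) with (step (T n)).
    destruct (T n) as [[x1 y1] s1]. cbn [fst snd step]. intros Hs1 HP.
    assert (Hh : 0 < s1 / 2) by lra.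
    assert (p * s1 = 2 * (p * (s1 / 2))) by field.
    assert (q * s1 = 2 * (q * (s1 / 2))) by field.
    assert (0 < p * (s1 / 2)) by nra. assert (0 < q * (s1 / 2)) by nra.
    destruct dec as [D1|D1]; [|cbn; repeat split; (easy || lra)].
    destruct dec as [D2|D2]; [|cbn; repeat split; (easy || lra)].
    destruct dec as [D3|D3]; [|cbn; repeat split; (easy || lra)].
    cbn; repeat split; try lra. intros D4. apply HP.
    replace s1 with (2 * (s1 / 2)) by field. now apply Hsub. }
  assert (HC : forall n, 0 < S' n /\ ~ P (X n) (Y n) (S' n) /\ S' n = s / 2 ^ n).
  { induction n as [|n [I1 [I2 I3]]].
    - unfold S', X, Y; cbn. repeat split; [easy|easy|field].
    - destruct (HB n I1 I2) as [B1 [B2 _]]. repeat split; [lra|easy|].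
      rewrite B2, I3. simpl. field. apply pow_nonzero; lra. }
  intros n. destruct (HC n) as [C1 [C2 C3]]. destruct (HB n C1 C2) as [_ [_ H]].
  repeat split; try easy; apply H. }
destruct (nested_intervals X (fun n => X n + p * S' n)) as [u Hu];
  [apply HT | apply HT | intros n; destruct (HT n) as [H _]; nra |].
destruct (nested_intervals Y (fun n => Y n + q * S' n)) as [v Hv];
  [apply HT | apply HT | intros n; destruct (HT n) as [H _]; nra |].
destruct (Hloc u v) as [d [d0 Hd]].
(* Makes [2 ^ n] exceed [s / d], so that the side parameter [s / 2 ^ n] is below [d]. *)
destruct (Pow_x_infinity 2) with (b := s / d + 1) as [n Hn].
{ rewrite Rabs_pos_eq; lra. }
specialize (Hn n (le_n n)). rewrite Rabs_pos_eq in Hn by (apply pow_le; lra).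
destruct (HT n) as [H1 [H2 [H3 _]]].
apply H2, Hd; [|apply Hu|apply Hv]. split; [easy|]. rewrite H3.
assert (0 < 2 ^ n) by (apply pow_lt; lra).
apply Rmult_lt_reg_r with (2 ^ n); [easy|].
replace (s / 2 ^ n * 2 ^ n) with s by (field; lra).
replace s with (s / d * d) by (field; lra). nra.
Qed.

(** The integral of [G] along the boundary of [[x, x + a] x [y, y + b]]. *)
Definition rect_int (G : C -> C) (x y a b : R) : C :=
  (RIntC (fun s => G (s, y)) x (x + a) - RIntC (fun s => G (s, (y + b)%R)) x (x + a) +
   Ci * (RIntC (fun u => G ((x + a)%R, u)) y (y + b) - RIntC (fun u => G (x, u)) y (y + b)))%C.

Lemma pcont_horizontal y s : pcont (fun s => (s, y)) s.
Proof.
intros eps He. exists eps; split; [easy|]. intros s' Hs'.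
replace ((s', y) - (s, y))%C with (RtoC (s' - s)).
now rewrite Cmod_R. unfold Cminus, Cplus, Copp, RtoC; simpl; f_equal; ring.
Qed.

Lemma pcont_vertical x s : pcont (fun s => (x, s)) s.
Proof.
intros eps He. exists eps; split; [easy|]. intros s' Hs'.
replace ((x, s') - (x, s))%C with (Ci * RtoC (s' - s))%C.
rewrite Cmod_mult, Cmod_Ci, Cmod_R. now rewrite Rmult_1_l.
unfold Cminus, Cplus, Cmult, Copp, RtoC, Ci; simpl; f_equal; ring.
Qed.

Definition cdiff (f : C -> C) (z : C) : Prop := exists d, cder f z d.

Lemma exRInt_horizontal G y a b : a <= b -> (forall s, a <= s <= b -> cdiff G (s, y)) ->
  ex_RIntC (fun s => G (s, y)) a b.
Proof.
intros Hab H. apply pcont_exRInt; [easy|]. intros s Hs.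
destruct (H s Hs) as [d Hd]. apply (cder_pcont G d (fun s => (s, y))). easy.
apply pcont_horizontal.
Qed.

Lemma exRInt_vertical G x a b : a <= b -> (forall s, a <= s <= b -> cdiff G (x, s)) ->
  ex_RIntC (fun s => G (x, s)) a b.
Proof.
intros Hab H. apply pcont_exRInt; [easy|]. intros s Hs.
destruct (H s Hs) as [d Hd]. apply (cder_pcont G d (fun s => (x, s))). easy.
apply pcont_vertical.
Qed.

(** Each inner edge is traversed twice in opposite directions. Only the outer edges are cut by
    Chasles' relation; the inner ones then cancel algebraically. *)
Lemma rect_int_split G x y a b : 0 <= a -> 0 <= b ->
  (forall s u, x <= s <= x + 2 * a -> y <= u <= y + 2 * b -> cdiff G (s, u)) ->
  rect_int G x y (2 * a) (2 * b) =
  (rect_int G x y a b + rect_int G (x + a) y a b + rect_int G x (y + b) a b +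
   rect_int G (x + a) (y + b) a b)%C.
Proof.
intros Ha Hb H. unfold rect_int.
replace (x + a + a) with (x + 2 * a) by ring. replace (y + b + b) with (y + 2 * b) by ring.
assert (HH : forall u, y <= u <= y + 2 * b ->
  RIntC (fun s => G (s, u)) x (x + 2 * a) =
  (RIntC (fun s => G (s, u)) x (x + a) + RIntC (fun s => G (s, u)) (x + a) (x + 2 * a))%C).
{ intros u Hu. apply RIntC_Chasles; apply exRInt_horizontal; try lra; intros; apply H; lra. }
assert (HV : forall s, x <= s <= x + 2 * a ->
  RIntC (fun u => G (s, u)) y (y + 2 * b) =
  (RIntC (fun u => G (s, u)) y (y + b) + RIntC (fun u => G (s, u)) (y + b) (y + 2 * b))%C).
{ intros s Hs. apply RIntC_Chasles; apply exRInt_vertical; try lra; intros; apply H; lra. }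
rewrite !HH, !HV by lra. ring.
Qed.

Lemma Cmod_le_sum (z : C) : Cmod z <= Rabs (fst z) + Rabs (snd z).
Proof.
unfold Cmod. apply Rsqr_incr_0_var.
rewrite Rsqr_sqrt by (assert (H1 := pow2_ge_0 (fst z)); assert (H2 := pow2_ge_0 (snd z)); lra).
assert (H1 := Rabs_pos (fst z)). assert (H2 := Rabs_pos (snd z)).
rewrite <- (pow2_abs (fst z)), <- (pow2_abs (snd z)). unfold Rsqr. nra.
assert (H1 := Rabs_pos (fst z)). assert (H2 := Rabs_pos (snd z)). lra.
Qed.

(* The affine part of [G] contributes nothing, and the remainder is small
   because the perimeter is at most a constant times the diameter. *)
Lemma rect_int_local G x y a b c d eta : 0 <= a -> 0 <= b -> 0 <= eta ->
  x <= fst c <= x + a -> y <= snd c <= y + b ->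
  (forall s u, x <= s <= x + a -> y <= u <= y + b -> cdiff G (s, u)) ->
  (forall s u, x <= s <= x + a -> y <= u <= y + b ->
     Cmod (G (s, u) - G c - d * ((s, u) - c)) <= eta * Cmod ((s, u) - c)) ->
  Cmod (rect_int G x y a b) <= 2 * eta * (a + b) * (a + b).
Proof.
intros Ha Hb He Hc1 Hc2 Hd HG.
set (E := fun w : C => (G w - G c - d * (w - c))%C).
assert (HE : forall s u, x <= s <= x + a -> y <= u <= y + b -> Cmod (E (s, u)) <= eta * (a + b)).
{ intros s u Hs Hu. eapply Rle_trans; [now apply HG|]. apply Rmult_le_compat_l; [easy|].
  eapply Rle_trans; [apply Cmod_le_sum|]. simpl.
  apply Rplus_le_compat; apply Rabs_le; lra. }
unfold rect_int. rewrite <- (RIntC_minus (fun s => G (s, y))) by (apply exRInt_horizontal; [lra|]; intros; apply Hd; lra).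
rewrite <- (RIntC_minus (fun u => G ((x + a)%R, u))) by (apply exRInt_vertical; [lra|]; intros; apply Hd; lra).
(* For the affine part, bottom minus top is constantly [- d * Ci * b] over a length [a], and right
   minus left is [d * a] over a length [b]; the factor [Ci] in [rect_int] makes the two
   contributions cancel. *)
assert (H1 : Cmod (RIntC (fun s => G (s, y) - G (s, (y + b)%R))%C x (x + a) - RtoC (x + a - x) * (- (d * Ci * RtoC b)))
  <= 2 * (eta * (a + b)) * (x + a - x)).
{ apply RIntC_dist_const; [lra| |].
  - apply (ex_RInt_minus (V := C_R_NormedModule)); (apply exRInt_horizontal; [lra|]; intros; apply Hd; lra).
  - intros s Hs.
    replace (G (s, y) - G (s, (y + b)%R) - - (d * Ci * RtoC b))%C with (E (s, y) - E (s, (y + b)%R))%C.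
    eapply Rle_trans; [apply Cmod_triangle|]. rewrite Cmod_opp.
    assert (K1 := HE s y ltac:(lra) ltac:(lra)). assert (K2 := HE s (y + b) ltac:(lra) ltac:(lra)). lra.
    unfold E. replace (s, (y + b)%R) with ((s, y) + Ci * RtoC b)%C at 2. ring.
    unfold Cplus, Cmult, RtoC, Ci; simpl; f_equal; ring. }
assert (H2 : Cmod (RIntC (fun u => G ((x + a)%R, u) - G (x, u))%C y (y + b) - RtoC (y + b - y) * (d * RtoC a))
  <= 2 * (eta * (a + b)) * (y + b - y)).
{ apply RIntC_dist_const; [lra| |].
  - apply (ex_RInt_minus (V := C_R_NormedModule)); (apply exRInt_vertical; [lra|]; intros; apply Hd; lra).
  - intros s Hs.
    replace (G ((x + a)%R, s) - G (x, s) - (d * RtoC a))%C with (E ((x + a)%R, s) - E (x, s))%C.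
    eapply Rle_trans; [apply Cmod_triangle|]. rewrite Cmod_opp.
    assert (K1 := HE x s ltac:(lra) ltac:(lra)). assert (K2 := HE (x + a) s ltac:(lra) ltac:(lra)). lra.
    unfold E. replace ((x + a)%R, s) with ((x, s) + RtoC a)%C at 2. ring.
    unfold Cplus, Cmult, RtoC, Ci; simpl; f_equal; ring. }
replace (x + a - x) with a in H1 by ring. replace (y + b - y) with b in H2 by ring.
match goal with |- Cmod (?u + Ci * ?v) <= _ =>
  replace (u + Ci * v)%C with ((u - RtoC a * - (d * Ci * RtoC b)) + Ci * (v - RtoC b * (d * RtoC a)))%C by ring
end.
eapply Rle_trans; [apply Cmod_triangle|]. rewrite Cmod_mult, Cmod_Ci, Rmult_1_l.
eapply Rle_trans; [apply Rplus_le_compat; [exact H1|exact H2]|]. right; ring.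
Qed.

(** The bound [eps * (s * s)] is additive under quartering, since four times it is the bound for
    [2 * s]. Differentiability gives it on small rectangles around each point, and [bisection]
    carries it to the whole one, for every [eps]. The inequalities inside [P] restrict it to
    subrectangles and make it vacuous elsewhere. *)
Lemma goursat_rect G x0 y0 a b : 0 < a -> 0 < b ->
  (forall s u, x0 <= s <= x0 + a -> y0 <= u <= y0 + b -> cdiff G (s, u)) ->
  rect_int G x0 y0 a b = RtoC 0.
Proof.
intros Ha Hb HG.
assert (Hmain : forall eps, 0 < eps -> Cmod (rect_int G x0 y0 a b) <= eps).
{ intros eps He.
  set (P := fun x y s => x0 <= x -> x + a * s <= x0 + a -> y0 <= y -> y + b * s <= y0 + b ->
     Cmod (rect_int G x y (a * s) (b * s)) <= eps * (s * s)).
  assert (HP : forall x y s, 0 < s -> P x y s).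
  { apply (bisection P a b Ha Hb).
    - intros x y s Hs P1 P2 P3 P4 K1 K2 K3 K4.
      assert (0 < a * s) by nra. assert (0 < b * s) by nra.
      replace (a * (2 * s)) with (2 * (a * s)) in * by ring.
      replace (b * (2 * s)) with (2 * (b * s)) in * by ring.
      rewrite rect_int_split; [|lra|lra|intros; apply HG; lra].
      specialize (P1 ltac:(lra) ltac:(lra) ltac:(lra) ltac:(lra)).
      specialize (P2 ltac:(lra) ltac:(lra) ltac:(lra) ltac:(lra)).
      specialize (P3 ltac:(lra) ltac:(lra) ltac:(lra) ltac:(lra)).
      specialize (P4 ltac:(lra) ltac:(lra) ltac:(lra) ltac:(lra)).
      assert (T1 := Cmod_triangle (rect_int G x y (a * s) (b * s)) (rect_int G (x + a * s) y (a * s) (b * s))).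
      assert (T2 := Cmod_triangle (rect_int G x y (a * s) (b * s) + rect_int G (x + a * s) y (a * s) (b * s))
        (rect_int G x (y + b * s) (a * s) (b * s))).
      eapply Rle_trans; [apply Cmod_triangle|]. lra.
    - intros u v.
      destruct (classic (x0 <= u <= x0 + a /\ y0 <= v <= y0 + b)) as [[Hu Hv]|Hn].
      + destruct (HG u v Hu Hv) as [d Hd].
        (* Turns the bound of [rect_int_local] for sides [a * s] and [b * s] into exactly
           [eps * (s * s)]. *)
        set (eta := eps / (2 * (a + b) * (a + b))).
        assert (Heta : 0 < eta) by (apply Rdiv_lt_0_compat; nra).
        destruct (proj1 (cder_eps _ _ _) Hd eta Heta) as [dl [dl0 Hdl]].
        exists (dl / (a + b)). split; [apply Rdiv_lt_0_compat; lra|].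
        intros x y s Hs Hxu Hyv K1 K2 K3 K4.
        assert (0 < a * s) by nra. assert (0 < b * s) by nra.
        assert (Hsd : a * s + b * s < dl).
        { apply Rlt_le_trans with ((a + b) * (dl / (a + b))); [nra|right; field; lra]. }
        replace (eps * (s * s)) with (2 * eta * (a * s + b * s) * (a * s + b * s))
          by (unfold eta; field; lra).
        apply rect_int_local with (c := (u, v)) (d := d); simpl; try lra.
        * intros; apply HG; lra.
        * intros s1 u1 Hs1 Hu1. apply Hdl.
          eapply Rle_lt_trans; [apply Cmod_le_sum|]. simpl.
          eapply Rle_lt_trans; [|exact Hsd].
          apply Rplus_le_compat; apply Rabs_le; lra.
      + exists 1. split; [lra|]. intros x y s Hs Hxu Hyv K1 K2 K3 K4.
        exfalso. apply Hn. split; lra. }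
  specialize (HP x0 y0 1 Rlt_0_1). unfold P in HP.
  rewrite !Rmult_1_r in HP. apply HP; lra. }
apply Cmod_eq_0. apply Rle_antisym; [|apply Cmod_ge_0].
apply le_epsilon. intros eps He. rewrite Rplus_0_l. now apply Hmain.
Qed.

(** * Cauchy's bound for the derivative *)

Definition cexp (z : C) : C := (exp (fst z) * cos (snd z), exp (fst z) * sin (snd z)).

Lemma cexp_plus z w : cexp (z + w) = (cexp z * cexp w)%C.
Proof.
unfold cexp, Cmult; simpl. rewrite exp_plus, cos_plus, sin_plus. f_equal; ring.
Qed.

Lemma Cmod_cexp z : Cmod (cexp z) = exp (fst z).
Proof.
unfold Cmod, cexp; simpl. assert (H := sin2_cos2 (snd z)). unfold Rsqr in H.
match goal with |- sqrt ?u = _ => replace u with (exp (fst z) * exp (fst z)) by nra end.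
apply sqrt_square, Rlt_le, exp_pos.
Qed.

Lemma cexp_0 : cexp (RtoC 0) = RtoC 1.
Proof. unfold cexp, RtoC; simpl. rewrite exp_0, cos_0, sin_0. f_equal; ring. Qed.

Lemma derivable_eps f x l : derivable_pt_lim f x l -> forall eps, 0 < eps ->
  exists d, 0 < d /\ forall h, Rabs h < d -> Rabs (f (x + h) - f x - l * h) <= eps * Rabs h.
Proof.
intros H eps He. destruct (H eps He) as [d Hd]. exists d. split; [apply cond_pos|].
intros h Hh. destruct (Req_dec h 0) as [->|Hn].
- rewrite Rplus_0_r. replace (f x - f x - l * 0) with 0 by ring. rewrite !Rabs_R0. lra.
- specialize (Hd h Hn Hh).
  replace (f (x + h) - f x - l * h) with (((f (x + h) - f x) / h - l) * h) by (field; easy).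
  rewrite Rabs_mult. apply Rmult_le_compat_r; [apply Rabs_pos|lra].
Qed.

Lemma Rabs_fst_Cmod (z : C) : Rabs (fst z) <= Cmod z.
Proof. eapply Rle_trans; [apply Rmax_l|apply Rmax_Cmod]. Qed.

Lemma Rabs_snd_Cmod (z : C) : Rabs (snd z) <= Cmod z.
Proof. eapply Rle_trans; [apply Rmax_r|apply Rmax_Cmod]. Qed.

(** By the functional equation only the expansion at 0 matters, and there it follows from the
    first-order expansions of the real functions [exp], [cos] and [sin]. *)
Lemma cder_cexp z : cder cexp z (cexp z).
Proof.
apply cder_eps. intros eps He.
set (c := exp (fst z)). assert (c0 : 0 < c) by apply exp_pos.
(* The number 7 is the sum 1 + 1 + 2 + 2 + 1 of the coefficients in [B1] to [B5], and [c] is the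
   modulus of [cexp z]. The cap 1 gives [|1 + x| <= 2]; the displacement is also kept below [eta],
   for the product [x * y] in [B5]. *)
set (eta := Rmin 1 (eps / (7 * c))).
assert (eta0 : 0 < eta) by (apply Rmin_glb_lt; [lra|apply Rdiv_lt_0_compat; lra]).
assert (eta1 : eta <= 1) by apply Rmin_l.
assert (eta2 : 7 * c * eta <= eps).
{ apply Rle_trans with (7 * c * (eps / (7 * c))); [|right; field; lra].
  apply Rmult_le_compat_l; [lra|apply Rmin_r]. }
clearbody eta.
destruct (derivable_eps _ _ _ (derivable_pt_lim_exp 0) eta eta0) as [d1 [d10 H1]].
destruct (derivable_eps _ _ _ (derivable_pt_lim_sin 0) eta eta0) as [d2 [d20 H2]].
destruct (derivable_eps _ _ _ (derivable_pt_lim_cos 0) eta eta0) as [d3 [d30 H3]].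
exists (Rmin (Rmin d1 d2) (Rmin d3 eta)).
split; [repeat apply Rmin_glb_lt; lra|]. intros w Hw.
assert (M1 := Rmin_l (Rmin d1 d2) (Rmin d3 eta)). assert (M2 := Rmin_r (Rmin d1 d2) (Rmin d3 eta)).
assert (M3 := Rmin_l d1 d2). assert (M4 := Rmin_r d1 d2).
assert (M5 := Rmin_l d3 eta). assert (M6 := Rmin_r d3 eta).
replace (cexp w) with (cexp z * cexp (w - z))%C by (rewrite <- cexp_plus; f_equal; ring).
set (h := (w - z)%C) in *. clearbody h.
replace (cexp z * cexp h - cexp z - cexp z * h)%C with (cexp z * (cexp h - RtoC 1 - h))%C by ring.
rewrite Cmod_mult, Cmod_cexp. fold c.
assert (A1 := Rabs_fst_Cmod h). assert (A2 := Rabs_snd_Cmod h).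
specialize (H1 (fst h) ltac:(lra)). specialize (H2 (snd h) ltac:(lra)). specialize (H3 (snd h) ltac:(lra)).
rewrite Rplus_0_l in H1, H2, H3. rewrite exp_0, Rmult_1_l in H1.
rewrite sin_0, cos_0, Rmult_1_l, Rminus_0_r in H2.
rewrite sin_0, cos_0 in H3. replace (cos (snd h) - 1 - - 0 * snd h) with (cos (snd h) - 1) in H3 by ring.
apply Rle_trans with (c * (7 * eta * Cmod h)); [|assert (P := Cmod_ge_0 h); nra].
apply Rmult_le_compat_l; [lra|].
eapply Rle_trans; [apply Cmod_le_sum|]. unfold cexp; simpl.
set (x := fst h) in *. set (y := snd h) in *.
assert (X0 := Rabs_pos x). assert (Y0 := Rabs_pos y).
replace (exp x * cos y + - (1) + - x) with ((exp x - 1 - x) * cos y + (1 + x) * (cos y - 1)) by ring.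
replace (exp x * sin y + - 0 + - y) with ((exp x - 1 - x) * sin y + (1 + x) * (sin y - y) + x * y) by ring.
assert (C1 : Rabs (cos y) <= 1) by (apply Rabs_le, COS_bound).
assert (S1 : Rabs (sin y) <= 1) by (apply Rabs_le, SIN_bound).
assert (O1 : Rabs (1 + x) <= 2).
{ eapply Rle_trans; [apply Rabs_triang|]. rewrite Rabs_R1. lra. }
assert (B1 : Rabs ((exp x - 1 - x) * cos y) <= eta * Rabs x).
{ rewrite Rabs_mult. assert (P := Rabs_pos (exp x - 1 - x)). nra. }
assert (B2 : Rabs ((exp x - 1 - x) * sin y) <= eta * Rabs x).
{ rewrite Rabs_mult. assert (P := Rabs_pos (exp x - 1 - x)). nra. }
assert (B3 : Rabs ((1 + x) * (cos y - 1)) <= 2 * (eta * Rabs y)).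
{ rewrite Rabs_mult. apply Rmult_le_compat; (apply Rabs_pos || easy). }
assert (B4 : Rabs ((1 + x) * (sin y - y)) <= 2 * (eta * Rabs y)).
{ rewrite Rabs_mult. apply Rmult_le_compat; (apply Rabs_pos || easy). }
assert (B5 : Rabs (x * y) <= eta * Rabs y).
{ rewrite Rabs_mult. apply Rmult_le_compat_r; lra. }
assert (T1 := Rabs_triang ((exp x - 1 - x) * cos y) ((1 + x) * (cos y - 1))).
assert (T2 := Rabs_triang ((exp x - 1 - x) * sin y + (1 + x) * (sin y - y)) (x * y)).
assert (T3 := Rabs_triang ((exp x - 1 - x) * sin y) ((1 + x) * (sin y - y))).
assert (L1 : eta * Rabs x <= eta * Cmod h) by (apply Rmult_le_compat_l; lra).
assert (L2 : eta * Rabs y <= eta * Cmod h) by (apply Rmult_le_compat_l; lra).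
lra.
Qed.

Lemma cexp_period x : cexp (x, (2 * PI)%R) = cexp (x, 0).
Proof. unfold cexp; simpl. now rewrite cos_2PI, sin_2PI, cos_0, sin_0. Qed.

Lemma cexp_period_neg x : cexp (- (x, (2 * PI)%R))%C = cexp (- (x, 0))%C.
Proof.
unfold cexp, Copp; simpl. rewrite !cos_neg, !sin_neg, cos_2PI, sin_2PI, Ropp_0, cos_0, sin_0.
now rewrite Ropp_0.
Qed.

(* In the coordinate [w = log (z - z0)] the function [(f z - f z0) / (z - z0)] is
   differentiable and [2 PI i]-periodic, so its mean over a vertical period does not depend on
   [Re w]; as [Re w] tends to minus infinity it tends to [f' z0]. *)
Lemma cauchy_derivative_bound f z0 d M r : 0 < r ->
  (forall w, Cmod (w - z0) <= r -> cdiff f w) -> cder f z0 d ->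
  (forall w, Cmod (w - z0) <= r -> Cmod (f w) <= M) -> Cmod d <= 2 * M / r.
Proof.
intros Hr Hf Hd HM.
assert (Hpi := PI_RGT_0).
set (G := fun w : C => ((f (z0 + cexp w) - f z0) * cexp (- w))%C).
assert (HG : forall s u, s <= ln r -> cdiff G (s, u)).
{ intros s u Hs.
  destruct (Hf (z0 + cexp (s, u))%C) as [d1 Hd1].
  { replace (z0 + cexp (s, u) - z0)%C with (cexp (s, u)) by ring. rewrite Cmod_cexp; simpl.
    rewrite <- (exp_ln r) by easy.
    destruct Hs as [Hs| ->]; [left; now apply exp_increasing|apply Rle_refl]. }
  eexists. unfold G. apply cder_mult.
  - apply cder_minus; [|apply cder_const].
    apply (cder_comp f (fun w => z0 + cexp w)%C); [exact Hd1|].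
    apply cder_plus; [apply cder_const|apply cder_cexp].
  - apply (cder_comp cexp (fun w => - w)%C); [apply cder_cexp|].
    apply (cder_ext_near (fun w => RtoC 0 - w)%C) with (r := 1); [lra|intros; ring|].
    apply cder_minus; [apply cder_const|apply cder_id]. }
set (J := fun x => RIntC (fun u => G (x, u)) 0 (2 * PI)).
(* Goursat's theorem over one full period: the horizontal edges carry the same values and cancel,
   which leaves the two vertical integrals. *)
assert (HJ : forall x, x < ln r -> J (ln r) = J x).
{ intros x Hx.
  assert (H := goursat_rect G x 0 (ln r - x) (2 * PI) ltac:(lra) ltac:(lra)
    ltac:(intros; apply HG; lra)).
  unfold rect_int in H.
  replace (RIntC (fun s => G (s, (0 + 2 * PI)%R)) x (x + (ln r - x)))
    with (RIntC (fun s => G (s, 0)) x (x + (ln r - x))) in H.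
  - replace (x + (ln r - x)) with (ln r) in H by ring. rewrite Rplus_0_l in H. fold (J (ln r)) (J x) in H.
    apply Ceq_minus. transitivity (/ Ci * (Ci * (J (ln r) - J x)))%C.
    field. exact Ci_nz.
    replace (Ci * (J (ln r) - J x))%C with (RtoC 0). ring. rewrite <- H. ring.
  - apply RIntC_ext; [lra|]. intros s _. unfold G. rewrite Rplus_0_l.
    now rewrite cexp_period, cexp_period_neg. }
assert (HJd : J (ln r) = (RtoC (2 * PI) * d)%C).
{ apply Ceq_minus, Cmod_eq_0. apply Rle_antisym; [|apply Cmod_ge_0].
  apply le_epsilon. intros eps He. rewrite Rplus_0_l.
  destruct (proj1 (cder_eps _ _ _) Hd (eps / (2 * PI))) as [dl [dl0 Hdl]].
  { apply Rdiv_lt_0_compat; lra. }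
  (* Strictly left of [ln r], so that [HJ] applies, and of [ln dl], so that [cexp (x, u)] has
     modulus below [dl]. *)
  set (x := Rmin (ln r) (ln dl) - 1).
  assert (X1 := Rmin_l (ln r) (ln dl)). assert (X2 := Rmin_r (ln r) (ln dl)).
  rewrite (HJ x) by (unfold x; lra). unfold J.
  replace (RtoC (2 * PI)) with (RtoC (2 * PI - 0)) by (f_equal; ring).
  replace eps with (eps / (2 * PI) * (2 * PI - 0)) by (field; lra).
  apply RIntC_dist_const; [lra| |].
  - apply exRInt_vertical; [lra|]. intros; apply HG; unfold x; lra.
  - intros u _. unfold G. set (k := cexp (x, u)).
    assert (Hk : Cmod k < dl).
    { unfold k. rewrite Cmod_cexp; simpl. rewrite <- (exp_ln dl) by easy.
      apply exp_increasing. unfold x; lra. }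
    specialize (Hdl (z0 + k)%C). replace (z0 + k - z0)%C with k in Hdl by ring.
    specialize (Hdl Hk).
    assert (Hkk : (cexp (- (x, u)) * k = RtoC 1)%C).
    { unfold k. rewrite <- cexp_plus, <- cexp_0. f_equal. ring. }
    replace ((f (z0 + k) - f z0) * cexp (- (x, u)) - d)%C
      with ((f (z0 + k) - f z0 - d * k) * cexp (- (x, u)))%C.
    2:{ replace ((f (z0 + k) - f z0 - d * k) * cexp (- (x, u)))%C
        with ((f (z0 + k) - f z0) * cexp (- (x, u)) - d * (cexp (- (x, u)) * k))%C by ring.
        rewrite Hkk. ring. }
    rewrite Cmod_mult.
    assert (Hk1 : Cmod (cexp (- (x, u))) * Cmod k = 1) by (rewrite <- Cmod_mult, Hkk; apply Cmod_1).
    apply Rle_trans with (eps / (2 * PI) * Cmod k * Cmod (cexp (- (x, u)))).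
    apply Rmult_le_compat_r; [apply Cmod_ge_0|easy]. rewrite Rmult_assoc, (Rmult_comm (Cmod k)), Hk1. lra. }
(* On the circle of radius [r] the numerator [f w - f z0] is at most [2 * M]; the subtracted [f z0]
   accounts for the factor 2 compared with the sharp bound [M / r]. *)
assert (HB : Cmod (J (ln r)) <= 2 * M / r * (2 * PI - 0)).
{ apply RIntC_bound; [lra| |].
  - apply exRInt_vertical; [lra|]. intros; apply HG; lra.
  - intros u _. unfold G. rewrite Cmod_mult, Cmod_cexp. simpl.
    rewrite exp_Ropp, exp_ln by easy. unfold Rdiv. apply Rmult_le_compat_r.
    apply Rlt_le, Rinv_0_lt_compat; easy.
    eapply Rle_trans; [apply Cmod_triangle|]. rewrite Cmod_opp.
    assert (K1 := HM (z0 + cexp (ln r, u))%C). assert (K2 := HM z0).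
    replace (z0 + cexp (ln r, u) - z0)%C with (cexp (ln r, u)) in K1 by ring.
    rewrite Cmod_cexp in K1; simpl in K1. rewrite exp_ln in K1 by easy.
    replace (z0 - z0)%C with (RtoC 0) in K2 by ring. rewrite Cmod_0 in K2.
    specialize (K1 (Rle_refl r)). specialize (K2 (Rlt_le _ _ Hr)). lra. }
rewrite HJd, Cmod_mult, Cmod_R, Rabs_pos_eq in HB by lra.
apply Rmult_le_reg_l with (2 * PI); lra.
Qed.

(** * Second-order bounds *)

Lemma cdiff_C_derive f z : cdiff f z -> cder f z (C_derive f z).
Proof. exact (C_derive_correct f z z). Qed.

Lemma cder_C_derive f z d : cder f z d -> C_derive f z = d.
Proof. exact (is_C_derive_unique f z d). Qed.

Definition pder (h : R -> C) (s : R) (l : C) : Prop :=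
  forall eps, 0 < eps -> exists delta, 0 < delta /\ forall s', Rabs (s' - s) < delta ->
    Cmod (h s' - h s - RtoC (s' - s) * l) <= eps * Rabs (s' - s).

Lemma pder_is_derive h s l : pder h s l -> is_derive (V := C_R_NormedModule) h s l.
Proof.
intros H. split; [apply is_linear_scal_l|].
intros x Hx. assert (E := is_filter_lim_locally_unique (V := R_NormedModule) _ _ Hx).
rewrite <- E. intros eps.
destruct (H eps (cond_pos eps)) as [d [d0 Hd]].
exists (mkposreal d d0). intros s' Hs'. specialize (Hd s' Hs').
rewrite norm_Cmod. rewrite scal_R_Cmult. exact Hd.
Qed.

Lemma cder_line f z v s d : cder f (z + RtoC s * v)%C d ->
  pder (fun s => f (z + RtoC s * v)%C) s (d * v)%C.
Proof.
intros Hf eps He.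
assert (V0 := Cmod_ge_0 v).
destruct (proj1 (cder_eps _ _ _) Hf (eps / (1 + Cmod v))) as [dl [dl0 Hdl]].
{ apply Rdiv_lt_0_compat; lra. }
assert (H1 : forall s', (z + RtoC s' * v - (z + RtoC s * v) = RtoC (s' - s) * v)%C).
{ intros s'. rewrite RtoC_minus. ring. }
exists (dl / (1 + Cmod v)). split; [apply Rdiv_lt_0_compat; lra|]. intros s' Hs'.
specialize (Hdl (z + RtoC s' * v)%C). rewrite H1, Cmod_mult, Cmod_R in Hdl.
assert (A0 := Rabs_pos (s' - s)).
replace (RtoC (s' - s) * (d * v))%C with (d * (RtoC (s' - s) * v))%C by ring.
eapply Rle_trans; [apply Hdl|].
- apply Rle_lt_trans with (Rabs (s' - s) * (1 + Cmod v)); [nra|].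
  apply Rmult_lt_reg_r with (/ (1 + Cmod v)); [apply Rinv_0_lt_compat; lra|].
  rewrite Rmult_assoc, Rinv_r, Rmult_1_r by lra. exact Hs'.
- replace (eps * Rabs (s' - s)) with (eps / (1 + Cmod v) * (Rabs (s' - s) * (1 + Cmod v))) by (field; lra).
  apply Rmult_le_compat_l; [apply Rlt_le, Rdiv_lt_0_compat; lra|nra].
Qed.

(** With [c] the conjugate of a vector, the real part of [c * h] is the inner product of [h] with
    that vector: a real function to which the mean value theorem applies. *)
Lemma pder_fst_mult h s l c : pder h s l ->
  derivable_pt_lim (fun s => fst (c * h s)%C) s (fst (c * l)%C).
Proof.
intros H eps He. assert (C0 := Cmod_ge_0 c).
destruct (H (eps / (1 + Cmod c))) as [d [d0 Hd]]; [apply Rdiv_lt_0_compat; lra|].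
exists (mkposreal d d0). intros k Hk Hkd. simpl in Hkd.
specialize (Hd (s + k)). replace (s + k - s) with k in Hd by ring. specialize (Hd Hkd).
replace ((fst (c * h (s + k)%R)%C - fst (c * h s)%C) / k - fst (c * l)%C)
  with (fst (c * (h (s + k)%R - h s - RtoC k * l))%C / k).
2:{ unfold Cmult, Cminus, Cplus, Copp, RtoC; simpl. field. easy. }
unfold Rdiv at 1. rewrite Rabs_mult, Rabs_inv.
assert (K0 := Rabs_pos_lt k Hk).
apply Rmult_lt_reg_r with (Rabs k); [easy|].
rewrite Rmult_assoc, Rinv_l, Rmult_1_r by lra.
eapply Rle_lt_trans; [apply Rabs_fst_Cmod|]. rewrite Cmod_mult.
eapply Rle_lt_trans; [apply Rmult_le_compat_l; [easy|exact Hd]|].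
apply Rlt_le_trans with ((1 + Cmod c) * (eps / (1 + Cmod c) * Rabs k)); [|right; field; lra].
apply Rmult_lt_compat_r; [|lra]. apply Rmult_lt_0_compat; [apply Rdiv_lt_0_compat; lra|easy].
Qed.

(* The real mean value theorem applied to the component of [f] in the direction [f w - f z]. *)
Lemma segment_increment_bound f z w M :
  (forall s, 0 <= s <= 1 -> exists d, cder f (z + RtoC s * (w - z))%C d /\ Cmod d <= M) ->
  Cmod (f w - f z) <= M * Cmod (w - z).
Proof.
intros H. set (u := (f w - f z)%C).
set (D := fun s => C_derive f (z + RtoC s * (w - z))%C).
assert (HD : forall s, 0 <= s <= 1 -> cder f (z + RtoC s * (w - z))%C (D s) /\ Cmod (D s) <= M).
{ intros s Hs. destruct (H s Hs) as [d [Hd HM]]. unfold D. rewrite (cder_C_derive _ _ _ Hd). easy. }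
destruct (MVT_cor3 (fun s => fst (Cconj u * f (z + RtoC s * (w - z)))%C)
  (fun s => fst (Cconj u * (D s * (w - z)))%C) 0 1 Rlt_0_1) as [c [Hc0 [Hc1 Hc]]].
{ intros s Hs0 Hs1. apply (pder_fst_mult (fun s => f (z + RtoC s * (w - z))%C)).
  apply cder_line. apply HD. lra. }
replace (z + RtoC 1 * (w - z))%C with w in Hc by ring.
replace (z + RtoC 0 * (w - z))%C with z in Hc by ring.
destruct (HD c (conj Hc0 Hc1)) as [_ HM].
(* The chosen component of [f] has increment [|u| ^ 2], while its derivative is at most
   [|u| * (M * |w - z|)]; one factor [|u|] cancels. *)
assert (E : Cmod u * Cmod u = fst (Cconj u * (D c * (w - z)))%C).
{ replace (fst (Cconj u * (D c * (w - z)))%C) with (fst (Cconj u * f w)%C - fst (Cconj u * f z)%C) by lra.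
  transitivity (fst u * fst u + snd u * snd u).
  - unfold Cmod. rewrite sqrt_sqrt; [ring|]. nra.
  - unfold u, Cconj, Cmult, Cminus, Cplus, Copp; simpl. ring. }
assert (U0 := Cmod_ge_0 u). assert (W0 := Cmod_ge_0 (w - z)).
assert (B : fst (Cconj u * (D c * (w - z)))%C <= Cmod u * (M * Cmod (w - z))).
{ eapply Rle_trans; [apply Rle_abs|]. eapply Rle_trans; [apply Rabs_fst_Cmod|].
  rewrite !Cmod_mult, Cmod_conj. apply Rmult_le_compat_l; [easy|]. now apply Rmult_le_compat_r. }
destruct U0 as [U0|U0].
- apply Rmult_le_reg_l with (Cmod u); lra.
- rewrite <- U0. apply Rmult_le_pos; [|easy]. eapply Rle_trans; [apply Cmod_ge_0|exact HM].
Qed.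

Lemma Cmod_dist_triangle (a b c : C) : Cmod (a - c) <= Cmod (a - b) + Cmod (b - c).
Proof. replace (a - c)%C with ((a - b) + (b - c))%C by ring. apply Cmod_triangle. Qed.

Lemma Cmod_segment (z w p : C) r s : 0 <= s <= 1 -> Cmod (z - p) <= r -> Cmod (w - p) <= r ->
  Cmod (z + RtoC s * (w - z) - p) <= r.
Proof.
intros Hs Hz Hw.
replace (z + RtoC s * (w - z) - p)%C with (RtoC (1 - s) * (z - p) + RtoC s * (w - p))%C
  by (rewrite RtoC_minus; ring).
eapply Rle_trans; [apply Cmod_triangle|]. rewrite !Cmod_mult, !Cmod_R, !Rabs_pos_eq by lra. nra.
Qed.

(* Cauchy's bound for the function [w => f (p + w) - f (z + w)]. *)
Lemma derivative_lipschitz f z M r : 0 < r ->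
  (forall w, Cmod (w - z) <= 4 * r -> cdiff f w) ->
  (forall w, Cmod (w - z) <= 4 * r -> Cmod (f w) <= M) ->
  forall p, Cmod (p - z) <= r ->
  Cmod (C_derive f p - C_derive f z) <= 2 * M / (r * r) * Cmod (p - z).
Proof.
intros Hr Hd HM p Hp.
(* The radius [4 * r] is spent in two halves: [p] and the translation [w] each move by at most [r],
   and the points reached still have a disk of radius [2 * r] for Cauchy's bound. *)
assert (A : forall q, Cmod (q - z) <= 2 * r -> exists d, cder f q d /\ Cmod d <= M / r).
{ intros q Hq. destruct (Hd q ltac:(lra)) as [d Hdq]. exists d; split; [easy|].
  replace (M / r) with (2 * M / (2 * r)) by (field; lra).
  apply (cauchy_derivative_bound f q d M (2 * r)); [lra| |easy|];
    intros w Hw; [apply Hd|apply HM]; assert (T := Cmod_dist_triangle w q z); lra. }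
set (F := fun w => (f (p + w) - f (z + w))%C).
assert (HF : forall w d1 d2, cder f (p + w)%C d1 -> cder f (z + w)%C d2 -> cder F w (d1 - d2)%C).
{ intros w d1 d2 H1 H2. unfold F.
  assert (HT : forall c, cder (fun w => c + w)%C w (RtoC 1)).
  { intros c. replace (RtoC 1) with (RtoC 0 + RtoC 1)%C by ring.
    apply cder_plus; [apply cder_const|apply cder_id]. }
  apply cder_minus.
  - replace d1 with (d1 * RtoC 1)%C by ring. apply (cder_comp f (fun w => p + w)%C); [easy|apply HT].
  - replace d2 with (d2 * RtoC 1)%C by ring. apply (cder_comp f (fun w => z + w)%C); [easy|apply HT]. }
assert (Hsh : forall q w, Cmod (q - z) <= r -> Cmod (w - RtoC 0) <= r -> Cmod (q + w - z) <= 2 * r).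
{ intros q w Hq Hw. replace (q + w - z)%C with ((q - z) + (w - RtoC 0))%C by ring.
  assert (T := Cmod_triangle (q - z) (w - RtoC 0)). lra. }
assert (Hz : Cmod (z - z) <= r) by (replace (z - z)%C with (RtoC 0) by ring; rewrite Cmod_0; lra).
replace (2 * M / (r * r) * Cmod (p - z)) with (2 * (M / r * Cmod (p - z)) / r) by (field; lra).
apply (cauchy_derivative_bound F (RtoC 0)); [easy| | |].
- intros w Hw. destruct (A (p + w)%C) as [d1 [H1 _]]; [auto|]. destruct (A (z + w)%C) as [d2 [H2 _]]; [auto|].
  exists (d1 - d2)%C. now apply HF.
- apply HF; rewrite Cplus_0_r; apply cdiff_C_derive, Hd; lra.
- intros w Hw. unfold F.
  replace (p - z)%C with (p + w - (z + w))%C by ring.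
  apply segment_increment_bound. intros s Hs. apply A. apply Cmod_segment; auto.
Qed.

(** The function [f w - C_derive f z * w] has derivative [C_derive f w - C_derive f z], which
    [derivative_lipschitz] makes small along the segment; the increment bound supplies the second
    factor [|w - z|]. *)
Lemma taylor_bound f z M r w : 0 < r ->
  (forall w, Cmod (w - z) <= 4 * r -> cdiff f w) ->
  (forall w, Cmod (w - z) <= 4 * r -> Cmod (f w) <= M) ->
  Cmod (w - z) <= r ->
  Cmod (f w - f z - C_derive f z * (w - z)) <= 2 * M / (r * r) * Cmod (w - z) * Cmod (w - z).
Proof.
intros Hr Hd HM Hw.
assert (M0 : 0 <= M).
{ eapply Rle_trans; [apply Cmod_ge_0|]. apply (HM w). lra. }
replace (f w - f z - C_derive f z * (w - z))%C with
  ((f w - C_derive f z * w) - (f z - C_derive f z * z))%C by ring.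
apply (segment_increment_bound (fun w => f w - C_derive f z * w)%C).
intros s Hs.
assert (Hseg : Cmod (z + RtoC s * (w - z) - z) <= Cmod (w - z)).
{ apply Cmod_segment; [easy| |lra]. replace (z - z)%C with (RtoC 0) by ring. rewrite Cmod_0. apply Cmod_ge_0. }
exists (C_derive f (z + RtoC s * (w - z)) - C_derive f z)%C. split.
- apply cder_minus; [apply cdiff_C_derive, Hd; lra|].
  replace (C_derive f z) with (RtoC 0 * (z + RtoC s * (w - z)) + C_derive f z * RtoC 1)%C at 2 by ring.
  apply (cder_mult (fun _ => C_derive f z) (fun w => w)); [apply cder_const|apply cder_id].
- eapply Rle_trans; [apply (derivative_lipschitz f z M r); auto; lra|].
  apply Rmult_le_compat_l; [|easy]. apply Rmult_le_pos; [lra|].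
  apply Rlt_le, Rinv_0_lt_compat; nra.
Qed.

Lemma cdiff_continuous f z : cdiff f z -> forall eps, 0 < eps -> exists delta, 0 < delta /\
  forall w, Cmod (w - z) < delta -> Cmod (f w - f z) < eps.
Proof.
intros [d Hf] eps He. destruct (proj1 (cder_eps _ _ _) Hf 1 Rlt_0_1) as [dl [dl0 Hdl]].
assert (Hm := Cmod_ge_0 d).
assert (He' : 0 < eps / (2 + Cmod d)) by (apply Rdiv_lt_0_compat; lra).
exists (Rmin dl (eps / (2 + Cmod d))). split; [now apply Rmin_glb_lt|].
intros w Hw.
assert (H1 := Rmin_l dl (eps / (2 + Cmod d))). assert (H2 := Rmin_r dl (eps / (2 + Cmod d))).
specialize (Hdl w ltac:(lra)). assert (W0 := Cmod_ge_0 (w - z)).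
replace (f w - f z)%C with ((f w - f z - d * (w - z)) + d * (w - z))%C by ring.
eapply Rle_lt_trans; [apply Cmod_triangle|]. rewrite Cmod_mult.
apply Rle_lt_trans with ((2 + Cmod d) * Cmod (w - z)); [nra|].
replace eps with ((2 + Cmod d) * (eps / (2 + Cmod d))) by (field; lra).
apply Rmult_lt_compat_l; lra.
Qed.

(** Compactness of the closed disk by [bisection]: a bound on four quarters gives one on the square,
    continuity gives one near each point of the closed disk, and small squares around any other
    point miss it. *)
Lemma analytic_locally_bounded f r : r < 1 -> analytic_on_disk f ->
  exists M, forall w, Cmod w <= r -> Cmod (f w) <= M.
Proof.
intros Hr Hf.
set (P := fun x y s => exists M, forall a b, x <= a <= x + 1 * s -> y <= b <= y + 1 * s ->
   Cmod (a, b) <= r -> Cmod (f (a, b)) <= M).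
assert (HP : forall x y s, 0 < s -> P x y s).
{ apply (bisection P 1 1 Rlt_0_1 Rlt_0_1).
  - intros x y s Hs [M1 H1] [M2 H2] [M3 H3] [M4 H4].
    exists (Rmax (Rmax M1 M2) (Rmax M3 M4)). intros a b Ha Hb Hab.
    assert (L1 := Rmax_l (Rmax M1 M2) (Rmax M3 M4)). assert (L2 := Rmax_r (Rmax M1 M2) (Rmax M3 M4)).
    assert (L3 := Rmax_l M1 M2). assert (L4 := Rmax_r M1 M2).
    assert (L5 := Rmax_l M3 M4). assert (L6 := Rmax_r M3 M4).
    destruct (Rle_lt_dec a (x + 1 * s)), (Rle_lt_dec b (y + 1 * s)).
    + specialize (H1 a b ltac:(lra) ltac:(lra) Hab). lra.
    + specialize (H3 a b ltac:(lra) ltac:(lra) Hab). lra.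
    + specialize (H2 a b ltac:(lra) ltac:(lra) Hab). lra.
    + specialize (H4 a b ltac:(lra) ltac:(lra) Hab). lra.
  - intros u v.
    assert (Hdist : forall d x y s a b, 0 < s < d / 2 ->
      x <= u <= x + 1 * s -> y <= v <= y + 1 * s -> x <= a <= x + 1 * s -> y <= b <= y + 1 * s ->
      Cmod ((a, b) - (u, v)) < d).
    { intros d x y s a b Hs Hu Hv Ha Hb. eapply Rle_lt_trans; [apply Cmod_le_sum|]. simpl.
      apply Rle_lt_trans with (s + s); [|lra]. apply Rplus_le_compat; apply Rabs_le; lra. }
    destruct (Rle_lt_dec (Cmod (u, v)) r) as [H|H].
    + destruct (cdiff_continuous f (u, v)) with (eps := 1) as [d [d0 Hd]]; [|lra|].
      { apply Hf. unfold in_disk. lra. }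
      exists (d / 2). split; [lra|]. intros x y s Hs Hu Hv.
      exists (Cmod (f (u, v)) + 1). intros a b Ha Hb _.
      specialize (Hd (a, b) (Hdist d x y s a b Hs Hu Hv Ha Hb)).
      replace (f (a, b)) with (f (u, v) + (f (a, b) - f (u, v)))%C by ring.
      assert (T := Cmod_triangle (f (u, v)) (f (a, b) - f (u, v))%C). lra.
    + exists ((Cmod (u, v) - r) / 2). split; [lra|]. intros x y s Hs Hu Hv.
      exists 0. intros a b Ha Hb Hab. exfalso.
      assert (D := Hdist (Cmod (u, v) - r) x y s a b Hs Hu Hv Ha Hb).
      assert (T := Cmod_triangle (a, b) ((u, v) - (a, b))%C).
      replace ((a, b) + ((u, v) - (a, b)))%C with (u, v) in T by (unfold Cplus, Cminus, Copp; simpl; f_equal; ring).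
      replace ((u, v) - (a, b))%C with (- ((a, b) - (u, v)))%C in T by (unfold Cminus, Cplus, Copp; simpl; f_equal; ring).
      rewrite Cmod_opp in T. lra. }
(* The square with corner [(-1, -1)] and side 2 contains the unit disk. *)
destruct (HP (-1) (-1) 2 ltac:(lra)) as [M HM].
exists M. intros [a b] Hab.
assert (K1 := Rabs_fst_Cmod (a, b)). assert (K2 := Rabs_snd_Cmod (a, b)). simpl in K1, K2.
assert (K3 := proj1 (Rabs_le_between a 1) ltac:(lra)).
assert (K4 := proj1 (Rabs_le_between b 1) ltac:(lra)).
apply HM; lra || exact Hab.
Qed.

(** * Primitives and limits of analytic functions *)

Lemma pcont_mult h k s : pcont h s -> pcont k s -> pcont (fun s => h s * k s)%C s.
Proof.
intros Hh Hk eps He.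
assert (H0 := Cmod_ge_0 (h s)). assert (K0 := Cmod_ge_0 (k s)).
set (m := 1 + Cmod (h s) + Cmod (k s)).
set (eta := Rmin 1 (eps / (2 * m))).
assert (e0 : 0 < eta) by (apply Rmin_glb_lt; [lra|apply Rdiv_lt_0_compat; unfold m; lra]).
assert (e1 : eta <= 1) by apply Rmin_l.
assert (e2 : eta * m < eps).
{ apply Rle_lt_trans with (eps / (2 * m) * m).
  apply Rmult_le_compat_r; [unfold m; lra|apply Rmin_r].
  replace (eps / (2 * m) * m) with (eps / 2) by (field; unfold m; lra). lra. }
clearbody eta.
destruct (Hh eta e0) as [d1 [d10 H1]]. destruct (Hk eta e0) as [d2 [d20 H2]].
exists (Rmin d1 d2). split; [now apply Rmin_glb_lt|]. intros s' Hs'.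
specialize (H1 s' (Rlt_le_trans _ _ _ Hs' (Rmin_l _ _))).
specialize (H2 s' (Rlt_le_trans _ _ _ Hs' (Rmin_r _ _))).
replace (h s' * k s' - h s * k s)%C
  with ((h s' - h s) * (k s' - k s) + h s * (k s' - k s) + (h s' - h s) * k s)%C by ring.
eapply Rle_lt_trans; [apply Cmod_triangle|].
assert (T := Cmod_triangle ((h s' - h s) * (k s' - k s)) (h s * (k s' - k s))).
rewrite !Cmod_mult in *.
assert (A := Cmod_ge_0 (h s' - h s)). assert (B := Cmod_ge_0 (k s' - k s)).
assert (L1 : Cmod (h s' - h s) * Cmod (k s' - k s) <= eta * 1) by (apply Rmult_le_compat; lra).
assert (L2 : Cmod (h s) * Cmod (k s' - k s) <= Cmod (h s) * eta) by (apply Rmult_le_compat_l; lra).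
assert (L3 : Cmod (h s' - h s) * Cmod (k s) <= eta * Cmod (k s)) by (apply Rmult_le_compat_r; lra).
unfold m in e2. lra.
Qed.

Lemma pcont_plus h k s : pcont h s -> pcont k s -> pcont (fun s => h s + k s)%C s.
Proof.
intros Hh Hk. apply continuous_pcont, (continuous_plus (V := C_R_NormedModule));
  now apply pcont_continuous.
Qed.

Lemma pcont_const c s : pcont (fun _ => c) s.
Proof. apply continuous_pcont, continuous_const. Qed.

Lemma pcont_RtoC s : pcont (fun s => RtoC s) s.
Proof. exact (pcont_horizontal 0 s). Qed.

Lemma pcont_ray z s : pcont (fun s => RtoC s * z)%C s.
Proof. apply pcont_mult; [apply pcont_RtoC|apply pcont_const]. Qed.

Lemma ray_in_disk z s : in_disk z -> 0 <= s <= 1 -> in_disk (RtoC s * z)%C.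
Proof.
unfold in_disk. intros Hz Hs. rewrite Cmod_mult, Cmod_R, Rabs_pos_eq by lra.
assert (H := Cmod_ge_0 z). nra.
Qed.

Lemma ray_shrinks z s : 0 <= s <= 1 -> Cmod (RtoC s * z) <= Cmod z.
Proof.
intros Hs. rewrite Cmod_mult, Cmod_R, Rabs_pos_eq by lra.
assert (H := Cmod_ge_0 z). nra.
Qed.

Lemma analytic_pcont_ray f z s : analytic_on_disk f -> in_disk z -> 0 <= s <= 1 ->
  pcont (fun s => f (RtoC s * z)%C) s.
Proof.
intros Hf Hz Hs. destruct (Hf _ (ray_in_disk z s Hz Hs)) as [d Hd].
apply (cder_pcont f d (fun s => RtoC s * z)%C); [exact Hd|apply pcont_ray].
Qed.

Lemma small_disk z w r : r <= (1 - Cmod z) / 2 -> Cmod (w - z) <= r -> Cmod w <= (1 + Cmod z) / 2.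
Proof.
intros Hr Hw. assert (T := Cmod_triangle (w - z) z). replace (w - z + z)%C with w in T by ring. lra.
Qed.

(** Continuity of the derivative is not part of analyticity; it comes from the Lipschitz bound
    around the point [s * z]. *)
Lemma analytic_derive_pcont_ray f z s : analytic_on_disk f -> in_disk z -> 0 <= s <= 1 ->
  pcont (fun s => C_derive f (RtoC s * z)%C) s.
Proof.
intros Hf Hz Hs. assert (Hp := ray_in_disk z s Hz Hs). unfold in_disk in Hp.
set (p := (RtoC s * z)%C) in *.
destruct (analytic_locally_bounded f ((1 + Cmod p) / 2) ltac:(lra) Hf) as [M HM].
set (r := (1 - Cmod p) / 8). assert (r0 : 0 < r) by (unfold r; lra).
assert (HL : forall w, Cmod (w - p) <= r ->
  Cmod (C_derive f w - C_derive f p) <= 2 * M / (r * r) * Cmod (w - p)).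
{ apply derivative_lipschitz; [easy| |]; intros w Hw;
    assert (Hw' := small_disk p w (4 * r) ltac:(unfold r; lra) Hw).
  - apply Hf. unfold in_disk. lra.
  - now apply HM. }
set (L := 2 * M / (r * r)) in *.
intros eps He.
assert (e0 : 0 < Rmin r (eps / (1 + Rabs L))).
{ assert (A := Rabs_pos L). apply Rmin_glb_lt; [easy|apply Rdiv_lt_0_compat; lra]. }
destruct (pcont_ray z s _ e0) as [d [d0 Hd]]. exists d; split; [easy|].
intros s' Hs'. specialize (Hd s' Hs'). cbv beta in Hd. fold p in Hd |- *.
assert (M1 := Rmin_l r (eps / (1 + Rabs L))). assert (M2 := Rmin_r r (eps / (1 + Rabs L))).
eapply Rle_lt_trans; [apply HL; lra|].
assert (A := Rabs_pos L). assert (A' := Rle_abs L). set (q := Cmod (RtoC s' * z - p)) in *.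
assert (q0 : 0 <= q) by apply Cmod_ge_0.
apply Rle_lt_trans with ((1 + Rabs L) * q); [nra|].
replace eps with ((1 + Rabs L) * (eps / (1 + Rabs L))) by (field; lra).
apply Rmult_lt_compat_l; lra.
Qed.

(** The mean of [h] over the segment from [0] to [z]; thus [CInt0 h z = z * ray_mean h z]. *)
Definition ray_mean (h : C -> C) (z : C) : C := RIntC (fun s => h (RtoC s * z)%C) 0 1.

Definition ray_mean_derive (h : C -> C) (z : C) : C :=
  RIntC (fun s => RtoC s * C_derive h (RtoC s * z))%C 0 1.

Lemma exRInt_ray h z : analytic_on_disk h -> in_disk z -> ex_RIntC (fun s => h (RtoC s * z)%C) 0 1.
Proof.
intros Hh Hz. apply pcont_exRInt; [lra|]. intros s Hs. now apply analytic_pcont_ray.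
Qed.

Lemma exRInt_ray_derive h z : analytic_on_disk h -> in_disk z ->
  ex_RIntC (fun s => RtoC s * C_derive h (RtoC s * z))%C 0 1.
Proof.
intros Hh Hz. apply pcont_exRInt; [lra|]. intros s Hs.
apply pcont_mult; [apply pcont_RtoC|now apply analytic_derive_pcont_ray].
Qed.

(** Differentiation under the integral sign. The disks of radius [4 * r] about all points of the
    segment stay in the disk of radius [(1 + |z|) / 2], so one [M] and one [r] serve in
    [taylor_bound] for every [s]. *)
Lemma ray_mean_cder h z : analytic_on_disk h -> in_disk z -> cder (ray_mean h) z (ray_mean_derive h z).
Proof.
intros Hh Hz. assert (Hz' := Hz). unfold in_disk in Hz'.
destruct (analytic_locally_bounded h ((1 + Cmod z) / 2) ltac:(lra) Hh) as [M HM].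
assert (M0 : 0 <= M).
{ eapply Rle_trans; [apply Cmod_ge_0|]. apply (HM z). lra. }
set (r := (1 - Cmod z) / 8). assert (r0 : 0 < r) by (unfold r; lra).
set (L := 2 * M / (r * r)).
assert (L0 : 0 <= L) by (apply Rmult_le_pos; [lra|apply Rlt_le, Rinv_0_lt_compat; nra]).
apply cder_eps. intros eps He.
exists (Rmin r (eps / (1 + L))).
split; [apply Rmin_glb_lt; [easy|apply Rdiv_lt_0_compat; lra]|].
intros w Hw.
assert (M1 := Rmin_l r (eps / (1 + L))). assert (M2 := Rmin_r r (eps / (1 + L))).
assert (Hwd : in_disk w).
{ unfold in_disk. assert (K := small_disk z w r ltac:(unfold r; lra) ltac:(lra)). lra. }
assert (W0 := Cmod_ge_0 (w - z)).
unfold ray_mean, ray_mean_derive.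
rewrite (Cmult_comm _ (w - z)).
rewrite <- RIntC_scal by now apply exRInt_ray_derive.
assert (E1 := exRInt_ray h w Hh Hwd). assert (E2 := exRInt_ray h z Hh Hz).
assert (E3 : ex_RIntC (fun s => (w - z) * (RtoC s * C_derive h (RtoC s * z)))%C 0 1).
{ eexists. apply is_RIntC_scal.
  exact (RInt_correct (V := C_R_CompleteNormedModule) _ _ _ (exRInt_ray_derive h z Hh Hz)). }
assert (E4 : ex_RIntC (fun s => h (RtoC s * w) - h (RtoC s * z))%C 0 1)
  by exact (ex_RInt_minus (V := C_R_NormedModule) _ _ _ _ E1 E2).
rewrite <- (RIntC_minus (fun s => h (RtoC s * w)%C)) by assumption.
rewrite <- (RIntC_minus (fun s => h (RtoC s * w) - h (RtoC s * z))%C) by assumption.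
eapply Rle_trans; [apply (RIntC_bound _ (L * Cmod (w - z) * Cmod (w - z)));
  [lra|exact (ex_RInt_minus (V := C_R_NormedModule) _ _ _ _ E4 E3)|]|].
- intros s Hs.
  assert (Hsw : Cmod (RtoC s * w - RtoC s * z) <= Cmod (w - z)).
  { replace (RtoC s * w - RtoC s * z)%C with (RtoC s * (w - z))%C by ring. now apply ray_shrinks. }
  replace ((w - z) * (RtoC s * C_derive h (RtoC s * z)))%C
    with (C_derive h (RtoC s * z) * (RtoC s * w - RtoC s * z))%C by ring.
  assert (Hball : forall q, Cmod (q - RtoC s * z) <= 4 * r -> Cmod q <= (1 + Cmod z) / 2).
  { intros q Hq. assert (T := Cmod_triangle (q - RtoC s * z) (RtoC s * z)).
    replace (q - RtoC s * z + RtoC s * z)%C with q in T by ring.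
    assert (S1 := ray_shrinks z s Hs). unfold r in Hq. lra. }
  eapply Rle_trans; [apply (taylor_bound h _ M r); [easy| | |lra]|].
  + intros q Hq. apply Hh. specialize (Hball q Hq). unfold in_disk. lra.
  + intros q Hq. apply HM, Hball, Hq.
  + fold L. assert (Q0 := Cmod_ge_0 (RtoC s * w - RtoC s * z)).
    apply Rmult_le_compat; [nra|easy| |easy]. now apply Rmult_le_compat_l.
- replace (1 - 0) with 1 by ring. rewrite Rmult_1_r. apply Rmult_le_compat_r; [easy|].
  apply Rle_trans with ((1 + L) * (eps / (1 + L))); [|right; field; lra].
  apply Rmult_le_compat; lra.
Qed.

(** Fundamental theorem of calculus along the ray: the integrand of the left-hand side is the
    derivative of [s * h (s * z)] in [s]. *)
Lemma ray_mean_derive_eq h z : analytic_on_disk h -> in_disk z ->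
  (ray_mean h z + z * ray_mean_derive h z)%C = h z.
Proof.
intros Hh Hz. unfold ray_mean, ray_mean_derive.
assert (E1 := exRInt_ray h z Hh Hz). assert (E2 := exRInt_ray_derive h z Hh Hz).
rewrite <- RIntC_scal by easy.
assert (E3 : ex_RIntC (fun s => z * (RtoC s * C_derive h (RtoC s * z)))%C 0 1).
{ eexists. apply is_RIntC_scal. exact (RInt_correct (V := C_R_CompleteNormedModule) _ _ _ E2). }
rewrite <- RIntC_plus by assumption.
assert (HD : is_RInt (V := C_R_NormedModule)
  (fun s => h (RtoC s * z) + z * (RtoC s * C_derive h (RtoC s * z)))%C 0 1
  (RtoC 1 * h (RtoC 1 * z) - RtoC 0 * h (RtoC 0 * z))%C).
{ apply (is_RInt_derive (V := C_R_CompleteNormedModule) (fun s => RtoC s * h (RtoC s * z))%C);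
    intros s; rewrite Rmin_left, Rmax_right by lra; intros Hs.
  - apply pder_is_derive.
    assert (H := Hh _ (ray_in_disk z s Hz Hs)). apply cdiff_C_derive in H.
    (* The path is the restriction of a complex function to the real line; base point 0 and
       direction 1 give it the shape required by [cder_line]. *)
    assert (HK : cder (fun p => p * h (p * z))%C (RtoC 0 + RtoC s * RtoC 1)%C
       (h (RtoC s * z) + RtoC s * (C_derive h (RtoC s * z) * z))%C).
    { replace (RtoC 0 + RtoC s * RtoC 1)%C with (RtoC s) by ring.
      replace (h (RtoC s * z))%C with (RtoC 1 * h (RtoC s * z))%C at 1 by ring.
      apply (cder_mult (fun p => p) (fun p => h (p * z)%C)); [apply cder_id|].
      apply (cder_comp h (fun p => p * z)%C); [exact H|].
      assert (Q := cder_mult (fun p => p) (fun _ => z) (RtoC s) _ _ (cder_id _) (cder_const _ _)). cbv beta in Q.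
      replace (RtoC 1 * z + RtoC s * RtoC 0)%C with z in Q by ring. exact Q. }
    assert (HP := cder_line _ _ _ _ _ HK).
    replace (h (RtoC s * z) + z * (RtoC s * C_derive h (RtoC s * z)))%C
      with ((h (RtoC s * z) + RtoC s * (C_derive h (RtoC s * z) * z)) * RtoC 1)%C by ring.
    intros eps He. destruct (HP eps He) as [d [d0 Hd]]. exists d; split; [easy|].
    intros s' Hs'. specialize (Hd s' Hs').
    replace (RtoC s') with (RtoC 0 + RtoC s' * RtoC 1)%C at 1 2 by ring.
    replace (RtoC s) with (RtoC 0 + RtoC s * RtoC 1)%C at 1 2 by ring. exact Hd.
  - apply pcont_continuous, pcont_plus; [now apply analytic_pcont_ray|].
    apply pcont_mult; [apply pcont_const|]. apply pcont_mult; [apply pcont_RtoC|].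
    now apply analytic_derive_pcont_ray. }
unfold RIntC. rewrite (is_RInt_unique (V := C_R_CompleteNormedModule) _ _ _ _ HD).
replace (RtoC 1 * z)%C with z by ring. ring.
Qed.

Lemma CInt0_ray_mean h z : CInt0 h z = (z * ray_mean h z)%C.
Proof. reflexivity. Qed.

(** The product rule for [z * ray_mean h z] together with [ray_mean_derive_eq]; path independence of
    the integral is not invoked. *)
Lemma CInt0_cder h z : analytic_on_disk h -> in_disk z -> cder (CInt0 h) z (h z).
Proof.
intros Hh Hz. rewrite <- (ray_mean_derive_eq h z Hh Hz).
replace (ray_mean h z) with (RtoC 1 * ray_mean h z)%C by ring.
apply (cder_mult (fun z => z) (ray_mean h)); [apply cder_id|now apply ray_mean_cder].
Qed.

Lemma C_cauchy_complete (u : nat -> C) :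
  (forall eps, 0 < eps -> exists N, forall n m, (N <= n)%nat -> (N <= m)%nat -> Cmod (u n - u m) <= eps) ->
  exists l, forall eps, 0 < eps -> exists N, forall n, (N <= n)%nat -> Cmod (u n - l) <= eps.
Proof.
intros H.
destruct (Rcomplete.R_complete (fun n => fst (u n))) as [a Ha].
{ intros eps He. destruct (H (eps / 2)) as [N HN]; [lra|]. exists N. intros n m Hn Hm.
  unfold R_dist. specialize (HN n m Hn Hm).
  assert (T := Rabs_fst_Cmod (u n - u m)). simpl in T. unfold Rminus. lra. }
destruct (Rcomplete.R_complete (fun n => snd (u n))) as [b Hb].
{ intros eps He. destruct (H (eps / 2)) as [N HN]; [lra|]. exists N. intros n m Hn Hm.
  unfold R_dist. specialize (HN n m Hn Hm).
  assert (T := Rabs_snd_Cmod (u n - u m)). simpl in T. unfold Rminus. lra. }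
exists (a, b). intros eps He.
destruct (Ha (eps / 2)) as [N1 H1]; [lra|]. destruct (Hb (eps / 2)) as [N2 H2]; [lra|].
exists (N1 + N2)%nat. intros n Hn. specialize (H1 n ltac:(lia)). specialize (H2 n ltac:(lia)).
unfold R_dist in *. eapply Rle_trans; [apply Cmod_le_sum|]. simpl. unfold Rminus in *. lra.
Qed.

(* Cauchy's bound makes the derivatives at [z] converge, and the quadratic remainder in
   Taylor's formula is uniform along the sequence. *)
Lemma analytic_limit (u : nat -> C -> C) f :
  (forall n, analytic_on_disk (u n)) ->
  (forall r eps, r < 1 -> 0 < eps -> exists N, forall n, (N <= n)%nat ->
     forall z, Cmod z <= r -> Cmod (u n z - f z) <= eps) ->
  analytic_on_disk f.
Proof.
intros Hu Hlim z Hz. unfold in_disk in Hz.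
set (R := (1 + Cmod z) / 2). assert (R1 : R < 1) by (unfold R; lra).
set (r := (1 - Cmod z) / 8). assert (r0 : 0 < r) by (unfold r; lra).
assert (Hball : forall w, Cmod (w - z) <= 4 * r -> Cmod w <= R).
{ intros w Hw. apply (small_disk z w (4 * r)); [unfold r; lra|easy]. }
assert (Hz0 : Cmod (z - z) <= 4 * r) by (replace (z - z)%C with (RtoC 0) by ring; rewrite Cmod_0; lra).
destruct (Hlim R 1 R1 Rlt_0_1) as [N0 HN0].
destruct (analytic_locally_bounded (u N0) R R1 (Hu N0)) as [M HM].
(* Both [u n] and [u N0] are within 1 of [f], hence the 2. This common bound makes the Taylor
   constant [L] independent of [n]. *)
assert (HMn : forall n, (N0 <= n)%nat -> forall w, Cmod w <= R -> Cmod (u n w) <= M + 2).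
{ intros n Hn w Hw. assert (A := HN0 n Hn w Hw). assert (B := HN0 N0 (le_n _) w Hw).
  specialize (HM w Hw). assert (T := Cmod_dist_triangle (u n w) (f w) (u N0 w)).
  replace (f w - u N0 w)%C with (- (u N0 w - f w))%C in T by ring. rewrite Cmod_opp in T.
  assert (T2 := Cmod_triangle (u n w - u N0 w) (u N0 w)).
  replace (u n w - u N0 w + u N0 w)%C with (u n w) in T2 by ring. lra. }
assert (Hd : forall n, cder (u n) z (C_derive (u n) z)) by (intros n; now apply cdiff_C_derive, Hu).
destruct (C_cauchy_complete (fun n => C_derive (u n) z)) as [d Hdl].
{ intros eps He. destruct (Hlim R (eps * r / 2) R1) as [N HN]; [nra|].
  exists N. intros n m Hn Hm.
  replace eps with (2 * (2 * (eps * r)) / (4 * r)) by (field; lra).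
  apply (cauchy_derivative_bound (fun w => u n w - u m w)%C z); [lra| | |].
  - intros w Hw. specialize (Hball w Hw).
    destruct (Hu n w) as [d1 D1]; [unfold in_disk; lra|]. destruct (Hu m w) as [d2 D2]; [unfold in_disk; lra|].
    exists (d1 - d2)%C. now apply cder_minus.
  - now apply cder_minus.
  - intros w Hw. specialize (Hball w Hw).
    assert (A := HN n Hn w Hball). assert (B := HN m Hm w Hball).
    replace (u n w - u m w)%C with ((u n w - f w) - (u m w - f w))%C by ring.
    eapply Rle_trans; [apply Cmod_triangle|]. rewrite Cmod_opp. nra. }
set (L := 2 * (M + 2) / (r * r)).
assert (HT : forall w, Cmod (w - z) <= r ->
  Cmod (f w - f z - d * (w - z)) <= L * Cmod (w - z) * Cmod (w - z)).
{ intros w Hw. apply le_epsilon. intros eps He.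
  destruct (Hlim R (eps / 3) R1) as [N1 H1]; [lra|].
  destruct (Hdl (eps / (3 * r))) as [N2 H2]; [apply Rdiv_lt_0_compat; lra|].
  set (n := (N0 + N1 + N2)%nat).
  specialize (H1 n ltac:(unfold n; lia)). specialize (H2 n ltac:(unfold n; lia)). simpl in H2.
  assert (A := H1 w (Hball w ltac:(lra))). assert (B := H1 z (Hball z Hz0)).
  assert (TB : Cmod (u n w - u n z - C_derive (u n) z * (w - z)) <= L * Cmod (w - z) * Cmod (w - z)).
  { apply taylor_bound; [easy| | |easy]; intros q Hq; specialize (Hball q Hq).
    - apply Hu. unfold in_disk. lra.
    - apply HMn; [unfold n; lia|easy]. }
  replace (f w - f z - d * (w - z))%C with
    ((u n w - u n z - C_derive (u n) z * (w - z)) + ((C_derive (u n) z - d) * (w - z)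
      + ((u n z - f z) - (u n w - f w))))%C by ring.
  eapply Rle_trans; [apply Cmod_triangle|]. apply Rplus_le_compat; [easy|].
  eapply Rle_trans; [apply Cmod_triangle|]. rewrite Cmod_mult.
  assert (T := Cmod_triangle (u n z - f z) (- (u n w - f w))). rewrite Cmod_opp in T.
  assert (Q : Cmod (C_derive (u n) z - d) * Cmod (w - z) <= eps / (3 * r) * r)
    by (apply Rmult_le_compat; (apply Cmod_ge_0 || easy)).
  replace (eps / (3 * r) * r) with (eps / 3) in Q by (field; lra).
  unfold Cminus in *. lra. }
exists d. apply cder_eps. intros eps He.
assert (A := Rabs_pos L). assert (A' := Rle_abs L).
exists (Rmin r (eps / (1 + Rabs L))).
split; [apply Rmin_glb_lt; [easy|apply Rdiv_lt_0_compat; lra]|].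
intros w Hw.
assert (M1 := Rmin_l r (eps / (1 + Rabs L))). assert (M2 := Rmin_r r (eps / (1 + Rabs L))).
eapply Rle_trans; [apply HT; lra|]. assert (W0 := Cmod_ge_0 (w - z)).
apply Rmult_le_compat_r; [easy|].
apply Rle_trans with ((1 + Rabs L) * (eps / (1 + Rabs L))); [|right; field; lra].
apply Rle_trans with ((1 + Rabs L) * Cmod (w - z)); [nra|]. apply Rmult_le_compat_l; lra.
Qed.

(** * Growth spaces *)

Definition growth_bounded (gamma : R) (f : C -> C) : Prop :=
  exists M, forall z, in_disk z -> growth_weight gamma f z <= M.

Lemma in_disk_0 : in_disk (RtoC 0).
Proof. unfold in_disk. rewrite Cmod_0. lra. Qed.

Lemma Rpower_pos x a : 0 < Rpower x a.
Proof. apply exp_pos. Qed.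

Lemma growth_weight_ge_0 gamma f z : 0 <= growth_weight gamma f z.
Proof. apply Rmult_le_pos; [apply Rlt_le, Rpower_pos|apply Cmod_ge_0]. Qed.

(** The norm is an extended supremum read through [real], which returns 0 at infinity. Boundedness
    excludes plus infinity, and the point 0 of the disk, by making the set nonempty, excludes minus
    infinity. *)
Lemma growth_norm_spec gamma f : growth_bounded gamma f ->
  (forall z, in_disk z -> growth_weight gamma f z <= growth_norm gamma f) /\
  (forall M, (forall z, in_disk z -> growth_weight gamma f z <= M) -> growth_norm gamma f <= M).
Proof.
intros [B HB]. unfold growth_norm.
set (E := fun x => exists z, in_disk z /\ x = growth_weight gamma f z).
assert (H := Lub_Rbar_correct E). destruct (Lub_Rbar E) as [l| |]; destruct H as [H1 H2].
- split.
  + intros z Hz. apply (H1 (growth_weight gamma f z)). now exists z.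
  + intros M HM. apply (H2 (Finite M)). intros x [z [Hz ->]]. simpl. now apply HM.
- exfalso. apply (H2 (Finite B)). intros x [z [Hz ->]]. simpl. now apply HB.
- exfalso. apply (H1 (growth_weight gamma f (RtoC 0))). exists (RtoC 0). split; [apply in_disk_0|easy].
Qed.

Lemma growth_weight_le_norm gamma f z : growth_bounded gamma f -> in_disk z ->
  growth_weight gamma f z <= growth_norm gamma f.
Proof. intros H. now apply growth_norm_spec. Qed.

Lemma growth_norm_le gamma f M : (forall z, in_disk z -> growth_weight gamma f z <= M) ->
  growth_norm gamma f <= M.
Proof. intros H. apply growth_norm_spec; [now exists M|easy]. Qed.

Lemma growth_norm_ge_0 gamma f : growth_bounded gamma f -> 0 <= growth_norm gamma f.
Proof.
intros H. eapply Rle_trans; [apply (growth_weight_ge_0 gamma f (RtoC 0))|].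
apply growth_weight_le_norm; [easy|apply in_disk_0].
Qed.

Lemma growth_weight_ext gamma f g z : f z = g z -> growth_weight gamma f z = growth_weight gamma g z.
Proof. unfold growth_weight. now intros ->. Qed.

Lemma growth_norm_ext gamma f g : eq_on_disk f g -> growth_norm gamma f = growth_norm gamma g.
Proof.
intros H. unfold growth_norm. f_equal. apply Lub_Rbar_eqset. intros x.
split; intros [z [Hz ->]]; exists z; (split; [easy|]); apply growth_weight_ext; [|symmetry]; now apply H.
Qed.

Lemma growth_weight_fadd gamma f g z :
  growth_weight gamma (fadd f g) z <= growth_weight gamma f z + growth_weight gamma g z.
Proof.
unfold growth_weight, fadd. rewrite <- Rmult_plus_distr_l.
apply Rmult_le_compat_l; [apply Rlt_le, Rpower_pos|apply Cmod_triangle].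
Qed.

Lemma growth_weight_fscal gamma a f z :
  growth_weight gamma (fscal a f) z = Cmod a * growth_weight gamma f z.
Proof. unfold growth_weight, fscal. rewrite Cmod_mult. ring. Qed.

Lemma growth_weight_fsub gamma f g z :
  growth_weight gamma (fsub f g) z <= growth_weight gamma f z + growth_weight gamma g z.
Proof.
unfold growth_weight, fsub. rewrite <- Rmult_plus_distr_l.
apply Rmult_le_compat_l; [apply Rlt_le, Rpower_pos|].
eapply Rle_trans; [apply Cmod_triangle|]. rewrite Cmod_opp. lra.
Qed.

Lemma growth_bounded_fadd gamma f g : growth_bounded gamma f -> growth_bounded gamma g ->
  growth_bounded gamma (fadd f g).
Proof.
intros [M HM] [N HN]. exists (M + N). intros z Hz.
eapply Rle_trans; [apply growth_weight_fadd|]. specialize (HM z Hz). specialize (HN z Hz). lra.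
Qed.

Lemma growth_bounded_fsub gamma f g : growth_bounded gamma f -> growth_bounded gamma g ->
  growth_bounded gamma (fsub f g).
Proof.
intros [M HM] [N HN]. exists (M + N). intros z Hz.
eapply Rle_trans; [apply growth_weight_fsub|]. specialize (HM z Hz). specialize (HN z Hz). lra.
Qed.

Lemma growth_bounded_fscal gamma a f : growth_bounded gamma f -> growth_bounded gamma (fscal a f).
Proof.
intros [M HM]. exists (Cmod a * M). intros z Hz. rewrite growth_weight_fscal.
apply Rmult_le_compat_l; [apply Cmod_ge_0|now apply HM].
Qed.

Lemma growth_norm_fscal gamma a f : growth_bounded gamma f ->
  growth_norm gamma (fscal a f) = Cmod a * growth_norm gamma f.
Proof.
intros Hf. assert (Haf := growth_bounded_fscal gamma a f Hf). assert (A0 := Cmod_ge_0 a).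
apply Rle_antisym.
- apply growth_norm_le. intros z Hz. rewrite growth_weight_fscal.
  apply Rmult_le_compat_l; [easy|now apply growth_weight_le_norm].
- destruct A0 as [A0|A0].
  + apply Rmult_le_reg_l with (/ Cmod a); [now apply Rinv_0_lt_compat|].
    rewrite <- Rmult_assoc, Rinv_l, Rmult_1_l by lra.
    apply growth_norm_le. intros z Hz.
    apply Rmult_le_reg_l with (Cmod a); [easy|].
    rewrite <- Rmult_assoc, Rinv_r, Rmult_1_l, <- growth_weight_fscal by lra.
    now apply growth_weight_le_norm.
  + rewrite <- A0, Rmult_0_l. now apply growth_norm_ge_0.
Qed.

(** Stated for any carrier of bounded weight, so that it covers [A] and [A0] at once. *)
Lemma growth_is_norm gamma (X : fspace) : fnorm X = growth_norm gamma ->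
  (forall f, X f -> growth_bounded gamma f) -> is_norm X.
Proof.
intros HX HB. unfold is_norm. rewrite HX. repeat split.
- intros f Hf. now apply growth_norm_ge_0, HB.
- intros H0 z Hz. apply Cmod_eq_0. apply Rle_antisym; [|apply Cmod_ge_0].
  assert (W := growth_weight_le_norm gamma f z (HB f H) Hz). rewrite H0 in W.
  unfold growth_weight in W. assert (P := Rpower_pos (1 - Cmod z) gamma). assert (Q := Cmod_ge_0 (f z)). nra.
- intros H0. apply Rle_antisym; [|now apply growth_norm_ge_0, HB].
  apply growth_norm_le. intros z Hz. unfold growth_weight. rewrite (H0 z Hz).
  unfold fzero. rewrite Cmod_0. lra.
- intros a f Hf. now apply growth_norm_fscal, HB.
- intros f g Hf Hg. apply growth_norm_le. intros z Hz.
  eapply Rle_trans; [apply growth_weight_fadd|].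
  apply Rplus_le_compat; apply growth_weight_le_norm; auto.
Qed.

Lemma analytic_ext f g : eq_on_disk f g -> analytic_on_disk f -> analytic_on_disk g.
Proof.
intros H Hf z Hz. destruct (Hf z Hz) as [d Hd]. exists d.
apply (cder_ext_near f g z d (1 - Cmod z)); [unfold in_disk in Hz; lra| |exact Hd].
intros w Hw. apply H. unfold in_disk.
assert (T := Cmod_triangle (w - z) z). replace (w - z + z)%C with w in T by ring. lra.
Qed.

Lemma analytic_const c : analytic_on_disk (fun _ => c).
Proof. intros z _. exists (RtoC 0). apply cder_const. Qed.

Lemma analytic_fadd f g : analytic_on_disk f -> analytic_on_disk g -> analytic_on_disk (fadd f g).
Proof.
intros Hf Hg z Hz. destruct (Hf z Hz) as [d1 H1], (Hg z Hz) as [d2 H2].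
exists (d1 + d2)%C. now apply cder_plus.
Qed.

Lemma analytic_fmult f g : analytic_on_disk f -> analytic_on_disk g ->
  analytic_on_disk (fun z => f z * g z)%C.
Proof.
intros Hf Hg z Hz. destruct (Hf z Hz) as [d1 H1], (Hg z Hz) as [d2 H2].
exists (d1 * g z + f z * d2)%C. now apply cder_mult.
Qed.

Lemma analytic_fscal a f : analytic_on_disk f -> analytic_on_disk (fscal a f).
Proof. intros Hf. apply (analytic_fmult (fun _ => a)); [apply analytic_const|easy]. Qed.

Lemma Rpower_le x y a : 0 < x <= y -> 0 < a -> Rpower x a <= Rpower y a.
Proof. intros Hxy Ha. apply Rle_Rpower_l; lra. Qed.

Lemma A_linear gamma : is_linear_subspace (A gamma).
Proof.
repeat split.
- intros f [H _]. exact H.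
- apply (analytic_ext f); [easy|apply H0].
- destruct H0 as [_ [M HM]]. exists M. intros z Hz.
  rewrite <- (growth_weight_ext gamma f g z (H z Hz)). now apply HM.
- apply analytic_const.
- exists 0. intros z _. unfold growth_weight, fzero. rewrite Cmod_0. lra.
- apply analytic_fadd; [apply H|apply H0].
- apply growth_bounded_fadd; [apply H|apply H0].
- apply analytic_fscal, H.
- apply growth_bounded_fscal, H.
Qed.

Lemma A0_linear gamma : is_linear_subspace (A0 gamma).
Proof.
split; [|split; [|split; [|split]]].
- intros f [H _]. exact H.
- intros f g H [H1 H2]. split; [now apply (analytic_ext f)|].
  intros eps He. destruct (H2 eps He) as [d [d0 Hd]]. exists d; split; [easy|].
  intros z Hz. rewrite <- (growth_weight_ext gamma f g z (H z (proj2 Hz))). now apply Hd.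
- split; [apply analytic_const|]. intros eps He. exists 1; split; [lra|]. intros z _.
  unfold growth_weight, fzero. rewrite Cmod_0. lra.
- intros f g [F1 F2] [G1 G2]. split; [now apply analytic_fadd|].
  intros eps He. destruct (F2 (eps / 2)) as [d [d0 Hd]]; [lra|].
  destruct (G2 (eps / 2)) as [e [e0 Hee]]; [lra|].
  exists (Rmin d e). split; [now apply Rmin_glb_lt|]. intros z Hz.
  assert (M1 := Rmin_l d e). assert (M2 := Rmin_r d e).
  eapply Rle_lt_trans; [apply growth_weight_fadd|].
  specialize (Hd z ltac:(lra)). specialize (Hee z ltac:(lra)). lra.
- intros a f [F1 F2]. split; [now apply analytic_fscal|].
  intros eps He. assert (P := Cmod_ge_0 a).
  destruct (F2 (eps / (1 + Cmod a))) as [d [d0 Hd]]; [apply Rdiv_lt_0_compat; lra|].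
  exists d; split; [easy|]. intros z Hz. specialize (Hd z Hz). rewrite growth_weight_fscal.
  assert (Q := growth_weight_ge_0 gamma f z).
  apply Rle_lt_trans with ((1 + Cmod a) * growth_weight gamma f z); [nra|].
  replace eps with ((1 + Cmod a) * (eps / (1 + Cmod a))) by (field; lra).
  apply Rmult_lt_compat_l; lra.
Qed.

(** Near the boundary the weighted values are below 1; on the remaining compact disk [f] is bounded
    and, since [gamma] is positive, the weight factor is at most 1. *)
Lemma A0_incl_A gamma f : 0 < gamma -> A0 gamma f -> A gamma f.
Proof.
intros Hg [Hf H]. split; [easy|]. destruct (H 1 Rlt_0_1) as [d [d0 Hd]].
destruct (analytic_locally_bounded f (1 - d)) as [M HM]; [lra|easy|].
exists (Rmax M 1). intros z Hz. unfold in_disk in Hz.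
destruct (Rle_lt_dec (Cmod z) (1 - d)) as [L|L].
- apply Rle_trans with M; [|apply Rmax_l]. specialize (HM z L).
  unfold growth_weight. assert (P := Cmod_ge_0 (f z)). assert (Z0 := Cmod_ge_0 z).
  assert (Q : Rpower (1 - Cmod z) gamma <= 1).
  { assert (E : Rpower 1 gamma = 1) by (unfold Rpower; rewrite ln_1, Rmult_0_r; apply exp_0).
    rewrite <- E. apply Rpower_le; lra. }
  assert (Q0 := Rpower_pos (1 - Cmod z) gamma). nra.
- apply Rle_trans with 1; [|apply Rmax_r]. specialize (Hd z ltac:(lra)). lra.
Qed.

(** A norm-Cauchy sequence converges pointwise, and uniformly once weighted. The weight is bounded
    below on each smaller disk, so convergence there is uniform and [analytic_limit] applies. *)
Lemma A_complete gamma (u : nat -> C -> C) : 0 < gamma -> (forall n, A gamma (u n)) ->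
  (forall eps : R, 0 < eps -> exists N : nat, forall m n : nat,
     (N <= m)%nat -> (N <= n)%nat -> growth_norm gamma (fsub (u m) (u n)) < eps) ->
  exists f, A gamma f /\ is_lim_seq (fun n => growth_norm gamma (fsub (u n) f)) 0.
Proof.
intros Hg Hu Hc.
assert (Hb : forall m n, growth_bounded gamma (fsub (u m) (u n))).
{ intros m n. apply growth_bounded_fsub; apply Hu. }
(* Stated for every [z], with a free value off the disk, so that choice yields a total function. *)
assert (Hpt : forall z, exists l, in_disk z ->
  forall eps, 0 < eps -> exists N, forall n, (N <= n)%nat -> Cmod (u n z - l) <= eps).
{ intros z. destruct (classic (in_disk z)) as [Hz|Hz]; [|now exists (RtoC 0)].
  destruct (C_cauchy_complete (fun n => u n z)) as [l Hl]; [|now exists l].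
  intros eps He. assert (P := Rpower_pos (1 - Cmod z) gamma).
  destruct (Hc (Rpower (1 - Cmod z) gamma * eps)) as [N HN]; [nra|].
  exists N. intros n m Hn Hm. specialize (HN n m Hn Hm).
  assert (W := growth_weight_le_norm gamma _ z (Hb n m) Hz). unfold growth_weight in W.
  change (fsub (u n) (u m) z) with (u n z - u m z)%C in W.
  apply Rmult_le_reg_l with (Rpower (1 - Cmod z) gamma); lra. }
set (f := fun z => proj1_sig (constructive_indefinite_description _ (Hpt z))).
assert (Hf : forall z, in_disk z -> forall eps, 0 < eps ->
  exists N, forall n, (N <= n)%nat -> Cmod (u n z - f z) <= eps).
{ intros z. exact (proj2_sig (constructive_indefinite_description _ (Hpt z))). }
clearbody f.
(* The comparison passes through some [u m] whose index may depend on [z]; only [N] must not. *)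
assert (Hunif : forall eps, 0 < eps -> exists N, forall n, (N <= n)%nat ->
  forall z, in_disk z -> growth_weight gamma (fsub (u n) f) z <= eps).
{ intros eps He. destruct (Hc eps He) as [N HN]. exists N. intros n Hn z Hz.
  apply le_epsilon. intros e1 He1. assert (P := Rpower_pos (1 - Cmod z) gamma).
  destruct (Hf z Hz (e1 / Rpower (1 - Cmod z) gamma)) as [N' HN']; [now apply Rdiv_lt_0_compat|].
  set (m := (N + N')%nat). specialize (HN' m ltac:(unfold m; lia)).
  specialize (HN n m Hn ltac:(unfold m; lia)).
  assert (W := growth_weight_le_norm gamma _ z (Hb n m) Hz).
  unfold growth_weight in W.
  change (fsub (u n) (u m) z) with (u n z - u m z)%C in W. unfold growth_weight, fsub.
  assert (T := Cmod_dist_triangle (u n z) (u m z) (f z)).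
  apply Rle_trans with (Rpower (1 - Cmod z) gamma * Cmod (u n z - u m z) +
    Rpower (1 - Cmod z) gamma * (e1 / Rpower (1 - Cmod z) gamma)).
  - rewrite <- Rmult_plus_distr_l. apply Rmult_le_compat_l; lra.
  - replace (Rpower (1 - Cmod z) gamma * (e1 / Rpower (1 - Cmod z) gamma)) with e1 by (field; lra). lra. }
exists f. split; [split|].
- apply (analytic_limit u); [intros n; apply Hu|].
  intros r eps Hr He. assert (P := Rpower_pos (1 - r) gamma).
  destruct (Hunif (Rpower (1 - r) gamma * eps)) as [N HN]; [nra|].
  exists N. intros n Hn z Hz. specialize (HN n Hn z ltac:(unfold in_disk; lra)).
  unfold growth_weight, fsub in HN.
  assert (Q : Rpower (1 - r) gamma <= Rpower (1 - Cmod z) gamma) by (apply Rpower_le; lra).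
  assert (K := Cmod_ge_0 (u n z - f z)).
  apply Rmult_le_reg_l with (Rpower (1 - r) gamma); [easy|]. nra.
- destruct (Hunif 1 Rlt_0_1) as [N HN]. destruct (Hu N) as [_ [M HM]].
  exists (M + 1). intros z Hz. specialize (HN N (le_n N) z Hz). specialize (HM z Hz).
  assert (T := growth_weight_fsub gamma (u N) (fsub (u N) f) z).
  rewrite (growth_weight_ext gamma f (fsub (u N) (fsub (u N) f)) z); [lra|unfold fsub; ring].
- apply is_lim_seq_spec. intros eps.
  destruct (Hunif (eps / 2)) as [N HN]; [destruct eps; simpl; lra|]. exists N. intros n Hn.
  assert (L := growth_norm_le gamma (fsub (u n) f) (eps / 2) (HN n Hn)).
  assert (G : 0 <= growth_norm gamma (fsub (u n) f)).
  { apply growth_norm_ge_0. exists (eps / 2). now apply HN. }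
  rewrite Rminus_0_r, Rabs_pos_eq by easy. destruct eps as [e e0]; simpl in *. lra.
Qed.

Lemma A_banach gamma : 0 < gamma -> is_banach (A gamma).
Proof.
intros Hg. split; [apply A_linear|split].
- apply (growth_is_norm gamma); [easy|]. now intros f [_ H].
- intros u Hu Hc. now apply A_complete.
Qed.

(** [A0] is closed in [A]: the limit is within [eps / 2] in norm of some [u N], whose weighted
    values are below [eps / 2] near the boundary. *)
Lemma A0_banach gamma : 0 < gamma -> is_banach (A0 gamma).
Proof.
intros Hg. split; [apply A0_linear|split].
- apply (growth_is_norm gamma); [easy|]. intros f Hf. now apply A0_incl_A.
- intros u Hu Hc. destruct (A_complete gamma u) as [f [Hf Hl]]; [easy| |easy|].
  { intros n. now apply A0_incl_A. }
  exists f. split; [|easy]. split; [apply Hf|]. intros eps He.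
  apply is_lim_seq_spec in Hl. destruct (Hl (mkposreal (eps / 2) ltac:(lra))) as [N HN].
  specialize (HN N (le_n N)). simpl in HN. rewrite Rminus_0_r in HN.
  assert (Hb : growth_bounded gamma (fsub (u N) f)).
  { apply growth_bounded_fsub; [now apply A0_incl_A|apply Hf]. }
  rewrite Rabs_pos_eq in HN by now apply growth_norm_ge_0.
  destruct (proj2 (Hu N) (eps / 2)) as [d [d0 Hd]]; [lra|].
  exists d; split; [easy|]. intros z Hz. specialize (Hd z Hz).
  assert (W := growth_weight_le_norm gamma _ z Hb (proj2 Hz)).
  assert (T := growth_weight_fsub gamma (u N) (fsub (u N) f) z).
  rewrite (growth_weight_ext gamma f (fsub (u N) (fsub (u N) f)) z); [lra|unfold fsub; ring].
Qed.

(** * Transfer of norm equivalence to optimal domains *)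

Lemma fsub_fadd f g : eq_on_disk (fsub f g) (fadd f (fscal (RtoC (-1)) g)).
Proof. intros z _. unfold fsub, fadd, fscal. ring. Qed.

Lemma linear_fsub (X : fspace) f g : is_linear_subspace X -> X f -> X g -> X (fsub f g).
Proof.
intros [_ [Hext [_ [Hadd Hsc]]]] Hf Hg.
apply (Hext (fadd f (fscal (RtoC (-1)) g))); [|now apply Hadd, Hsc].
intros z Hz. symmetry. now apply fsub_fadd.
Qed.

(** Linearity up to equality on the disk. The first clause makes [T] well defined on functions
    identified by [eq_on_disk]. *)
Definition disk_linear (T : (C -> C) -> C -> C) : Prop :=
  (forall f g, eq_on_disk f g -> eq_on_disk (T f) (T g)) /\
  (forall f g, analytic_on_disk f -> analytic_on_disk g -> eq_on_disk (T (fadd f g)) (fadd (T f) (T g))) /\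
  (forall a f, analytic_on_disk f -> eq_on_disk (T (fscal a f)) (fscal a (T f))).

(** The inequality with [K2] makes the seminorm definite and turns a Cauchy sequence for it into one
    of [Y]; the limit found in [Y] is a limit for the seminorm by the inequality with [K1]. *)
Lemma optimal_domain_banach_eq T (X Y : fspace) K1 K2 :
  is_linear_subspace X -> is_norm X ->
  (forall f g, eq_on_disk f g -> fnorm X f = fnorm X g) ->
  is_banach Y -> disk_linear T ->
  (forall f, analytic_on_disk f /\ X (T f) <-> Y f) -> 0 < K1 -> 0 < K2 ->
  (forall f, Y f -> fnorm X (T f) <= K1 * fnorm Y f) ->
  (forall f, Y f -> fnorm Y f <= K2 * fnorm X (T f)) ->
  banach_eq (optimal_domain T X) Y.
Proof.
intros XL XN Xext HY [Text [Tadd Tscal]] HXY K10 K20 HT1 HT2.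
assert (HY' := HY). destruct HY as [YL [YN YC]].
assert (YL' := YL). destruct YL as [Yan [Yext [Y0 [Yadd Yscal]]]].
destruct YN as [YN0 [YN1 [YN2 YN3]]]. destruct XN as [XN0 [XN1 [XN2 XN3]]].
assert (toY : forall f, optimal_domain T X f -> Y f) by (intros f; exact (proj1 (HXY f))).
assert (ofY : forall f, Y f -> optimal_domain T X f) by (intros f; exact (proj2 (HXY f))).
split; [|split; [easy|split; [intros f; split; auto|]]].
2:{ exists (/ K1), K2. split; [now apply Rinv_0_lt_compat|split; [easy|]].
    intros f Hf. apply toY in Hf. split; [|now apply HT2]. simpl.
    apply Rmult_le_reg_l with K1; [easy|]. rewrite <- Rmult_assoc, Rinv_r, Rmult_1_l by lra. now apply HT1. }
split; [|split].
- split; [|split; [|split; [|split]]].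
  + now intros f [H _].
  + intros f g Hfg Hf. exact (ofY g (Yext f g Hfg (toY f Hf))).
  + exact (ofY _ Y0).
  + intros f g Hf Hg. exact (ofY _ (Yadd f g (toY f Hf) (toY g Hg))).
  + intros a f Hf. exact (ofY _ (Yscal a f (toY f Hf))).
- split; [|split; [|split]]; simpl.
  + intros f [_ Hf]. now apply XN0.
  + intros f Hf. assert (HYf := toY f Hf). rewrite <- (YN1 f HYf).
    assert (A := HT1 f HYf). assert (B := HT2 f HYf).
    assert (P := YN0 f HYf). assert (Q := XN0 _ (proj2 Hf)).
    split; intros E; rewrite E in *; nra.
  + intros a f [Hf HXf]. rewrite (Xext _ _ (Tscal a f Hf)). now apply XN2.
  + intros f g [Hf HXf] [Hg HXg]. rewrite (Xext _ _ (Tadd f g Hf Hg)). now apply XN3.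
- intros u Hu Hc. simpl in Hc.
  assert (HuY : forall n, Y (u n)) by (intros n; exact (toY _ (Hu n))).
  destruct (YC u HuY) as [f [Hf Hl]].
  { intros eps He. destruct (Hc (eps / K2)) as [N HN]; [now apply Rdiv_lt_0_compat|].
    exists N. intros m n Hm Hn. specialize (HN m n Hm Hn).
    eapply Rle_lt_trans; [apply HT2, linear_fsub; auto|].
    replace eps with (K2 * (eps / K2)) by (field; lra). now apply Rmult_lt_compat_l. }
  exists f. split; [exact (ofY f Hf)|]. simpl.
  apply is_lim_seq_le_le with (u := fun _ => 0) (w := fun n => K1 * fnorm Y (fsub (u n) f)).
  + intros n. assert (HYn : Y (fsub (u n) f)) by (apply linear_fsub; auto).
    split; [exact (XN0 _ (proj2 (ofY _ HYn)))|now apply HT1].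
  + apply is_lim_seq_const.
  + replace (Finite 0) with (Rbar_mult K1 0) by (simpl; f_equal; ring).
    now apply is_lim_seq_scal_l.
Qed.

Lemma banach_eq_sym X Y : banach_eq X Y -> banach_eq Y X.
Proof.
intros [HX [HY [H [c [K [c0 [K0 HN]]]]]]]. split; [easy|split; [easy|split]].
- intros f. symmetry. apply H.
- exists (/ K), (/ c). split; [now apply Rinv_0_lt_compat|split; [now apply Rinv_0_lt_compat|]].
  intros f Hf. apply H in Hf. destruct (HN f Hf) as [H1 H2]. split.
  + apply Rmult_le_reg_l with K; [easy|]. rewrite <- Rmult_assoc, Rinv_r, Rmult_1_l; lra.
  + apply Rmult_le_reg_l with c; [easy|]. rewrite <- Rmult_assoc, Rinv_r, Rmult_1_l; lra.
Qed.

Lemma banach_eq_trans X Y Z : banach_eq X Y -> banach_eq Y Z -> banach_eq X Z.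
Proof.
intros [HX [HY [H [c [K [c0 [K0 HN]]]]]]] [_ [HZ [H' [c' [K' [c0' [K0' HN']]]]]]].
split; [easy|split; [easy|split]].
- intros f. now rewrite H.
- exists (c' * c), (K' * K). split; [nra|split; [nra|]].
  intros f Hf. destruct (HN f Hf) as [H1 H2]. apply H in Hf. destruct (HN' f Hf) as [H3 H4]. split.
  + eapply Rle_trans; [|exact H3]. rewrite Rmult_assoc. apply Rmult_le_compat_l; lra.
  + eapply Rle_trans; [exact H4|]. rewrite Rmult_assoc. apply Rmult_le_compat_l; lra.
Qed.

(** * Bounds for the Cesaro operator *)

Lemma cder_Cinv z : z <> RtoC 0 -> cder Cinv z (- / (z * z))%C.
Proof.
intros Hz. assert (Z0 := proj1 (Cmod_gt_0 z) Hz). set (m := Cmod z) in *.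
apply cder_eps. intros eps He.
(* The remainder is [(w - z) ^ 2 / (w * z ^ 2)]. The first entry keeps [|w|] above [m / 2], so the
   denominator exceeds [m ^ 3 / 2]; the second then gives [eps]. *)
exists (Rmin (m / 2) (eps * (m * m * m) / 2)).
assert (m3 : 0 < m * m * m) by (repeat apply Rmult_lt_0_compat; easy).
split; [apply Rmin_glb_lt; nra|]. intros w Hw.
assert (M1 := Rmin_l (m / 2) (eps * (m * m * m) / 2)). assert (M2 := Rmin_r (m / 2) (eps * (m * m * m) / 2)).
assert (T := Cmod_triangle w (- (w - z))). rewrite Cmod_opp in T.
replace (w + - (w - z))%C with z in T by ring. fold m in T.
assert (W0 : m / 2 < Cmod w) by lra.
assert (Hw0 : w <> RtoC 0) by (apply Cmod_gt_0; lra).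
replace (/ w - / z - - / (z * z) * (w - z))%C with ((w - z) * (w - z) * / (w * (z * z)))%C by (field; easy).
rewrite !Cmod_mult, Cmod_inv, !Cmod_mult by (repeat apply Cmult_neq_0; easy). fold m.
set (q := Cmod (w - z)) in *. assert (q0 : 0 <= q) by apply Cmod_ge_0.
rewrite (Rmult_comm eps), Rmult_assoc. apply Rmult_le_compat_l; [easy|].
assert (B : m * m * m / 2 < Cmod w * (m * m)) by nra.
apply Rmult_le_reg_r with (Cmod w * (m * m)); [lra|].
rewrite Rmult_assoc, Rinv_l, Rmult_1_r by lra. nra.
Qed.

Lemma one_minus_tz_bounds t z : 0 <= t < 1 -> in_disk z ->
  1 - t <= Cmod (RtoC 1 - RtoC t * z) <= 2.
Proof.
unfold in_disk. intros Ht Hz. assert (Z0 := Cmod_ge_0 z).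
assert (E : Cmod (RtoC t * z) = t * Cmod z) by (rewrite Cmod_mult, Cmod_R, Rabs_pos_eq; lra).
split.
- assert (T := Cmod_triangle (RtoC 1 - RtoC t * z) (RtoC t * z)).
  replace (RtoC 1 - RtoC t * z + RtoC t * z)%C with (RtoC 1) in T by ring.
  rewrite Cmod_1, E in T. nra.
- eapply Rle_trans; [apply Cmod_triangle|]. rewrite Cmod_opp, Cmod_1, E. nra.
Qed.

Lemma one_minus_tz_neq_0 t z : 0 <= t < 1 -> in_disk z -> (RtoC 1 - RtoC t * z)%C <> RtoC 0.
Proof. intros Ht Hz. apply Cmod_gt_0. assert (H := one_minus_tz_bounds t z Ht Hz). lra. Qed.

Lemma analytic_inv g : analytic_on_disk g -> (forall z, in_disk z -> g z <> RtoC 0) ->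
  analytic_on_disk (fun z => / g z)%C.
Proof.
intros Hg H0 z Hz. destruct (Hg z Hz) as [d Hd]. eexists.
apply (cder_comp Cinv g); [now apply cder_Cinv, H0|exact Hd].
Qed.

Lemma analytic_affine a b : analytic_on_disk (fun z => a - b * z)%C.
Proof.
intros z _. eexists. apply cder_minus; [apply cder_const|].
apply (cder_mult (fun _ => b) (fun w => w)); [apply cder_const|apply cder_id].
Qed.

Definition cesaro_kernel (t : R) (f : C -> C) (xi : C) : C :=
  Cdiv (f xi) (Cminus (RtoC 1) (Cmult (RtoC t) xi)).

Lemma analytic_cesaro_kernel t f : 0 <= t < 1 -> analytic_on_disk f ->
  analytic_on_disk (cesaro_kernel t f).
Proof.
intros Ht Hf. apply (analytic_fmult f); [easy|]. apply analytic_inv; [apply analytic_affine|].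
intros z Hz. now apply one_minus_tz_neq_0.
Qed.

Lemma ray_mean_analytic h : analytic_on_disk h -> analytic_on_disk (ray_mean h).
Proof. intros Hh z Hz. eexists. now apply ray_mean_cder. Qed.

Lemma CInt0_analytic h : analytic_on_disk h -> analytic_on_disk (CInt0 h).
Proof. intros Hh z Hz. eexists. now apply CInt0_cder. Qed.

Lemma ray_mean_0 h : ray_mean h (RtoC 0) = h (RtoC 0).
Proof.
unfold ray_mean. rewrite (RIntC_ext _ (fun _ => h (RtoC 0))); [|lra|].
- unfold RIntC. rewrite RInt_const. rewrite scal_R_Cmult. 
  replace (1 - 0) with 1 by ring. apply Cmult_1_l.
- intros s _. f_equal. ring.
Qed.

(** The value prescribed at 0 is the mean over the degenerate segment, where the kernel's
    denominator is 1; the case distinction in [Ces] thus disappears. *)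
Lemma Ces_ray_mean t f z : Ces t f z = ray_mean (cesaro_kernel t f) z.
Proof.
unfold Ces. destruct (Ceq_dec z (RtoC 0)) as [->|Hz].
- rewrite ray_mean_0. unfold cesaro_kernel. field.
- fold (cesaro_kernel t f). rewrite CInt0_ray_mean. field. exact Hz.
Qed.

Lemma ray_mean_ext h k z : in_disk z -> eq_on_disk h k -> ray_mean h z = ray_mean k z.
Proof.
intros Hz H. apply RIntC_ext; [lra|]. intros s Hs. apply H, ray_in_disk; [easy|lra].
Qed.

Lemma cesaro_kernel_fadd t f g : eq_on_disk (cesaro_kernel t (fadd f g)) (fadd (cesaro_kernel t f) (cesaro_kernel t g)).
Proof. intros z _. unfold cesaro_kernel, fadd, Cdiv. ring. Qed.

Lemma Ces_linear t : 0 <= t < 1 -> disk_linear (Ces t).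
Proof.
intros Ht. split; [|split].
- intros f g H z Hz. rewrite !Ces_ray_mean. apply ray_mean_ext; [easy|].
  intros w Hw. unfold cesaro_kernel. now rewrite H.
- intros f g Hf Hg z Hz. unfold fadd at 2. rewrite !Ces_ray_mean.
  rewrite (ray_mean_ext _ _ z Hz (cesaro_kernel_fadd t f g)).
  apply RIntC_plus; apply exRInt_ray; auto using analytic_cesaro_kernel.
- intros a f Hf z Hz. unfold fscal at 2. rewrite !Ces_ray_mean.
  rewrite (ray_mean_ext _ (fun w => a * cesaro_kernel t f w)%C z Hz).
  + apply (RIntC_scal (fun s => cesaro_kernel t f (RtoC s * z))%C).
    apply exRInt_ray; auto using analytic_cesaro_kernel.
  + intros w _. unfold cesaro_kernel, fscal, Cdiv. ring.
Qed.

Lemma Rpower_neg_le x y a : 0 < x <= y -> 0 < a -> Rpower y (- a) <= Rpower x (- a).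
Proof.
intros Hxy Ha. rewrite !Rpower_Ropp. apply Rinv_le_contravar; [apply Rpower_pos|now apply Rpower_le].
Qed.

Lemma growth_weight_le_iff a f z M :
  growth_weight a f z <= M <-> Cmod (f z) <= M * Rpower (1 - Cmod z) (- a).
Proof.
unfold growth_weight. rewrite Rpower_Ropp. assert (P := Rpower_pos (1 - Cmod z) a).
set (p := Rpower _ _) in *. split; intros H.
- apply Rmult_le_reg_l with p; [easy|]. replace (p * (M * / p)) with M by (field; lra). easy.
- apply Rmult_le_compat_l with (r := p) in H; [|lra]. replace (p * (M * / p)) with M in H by (field; lra). easy.
Qed.

(* [1 - s r >= ((1 - s) + (1 - r)) / 2], and the power of the right-hand side has an explicit primitive. *)
Lemma ray_mean_bound h z gamma B N : 0 < gamma -> analytic_on_disk h -> in_disk z -> 0 <= B -> 0 <= N ->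
  (forall w, Cmod w <= Cmod z -> Cmod (h w) <= B + N * Rpower (1 - Cmod w) (- (gamma + 1))) ->
  Cmod (ray_mean h z) <= B + Rpower 2 (gamma + 1) / gamma * N * Rpower (1 - Cmod z) (- gamma).
Proof.
intros Hg Hh Hz HB HN H. assert (Z0 := Cmod_ge_0 z). assert (Hz' := Hz). unfold in_disk in Hz'.
set (r := Cmod z) in *.
set (K := Rpower 2 (gamma + 1)). assert (K0 : 0 < K) by apply Rpower_pos.
(* A primitive of the majorant; [K] compensates the factor 1/2 in the lower bound for
   [1 - s * r]. *)
set (F := fun s => B * s + N * K / gamma * Rpower (2 - s - r) (- gamma)).
assert (HF : is_RInt (V := R_NormedModule) (fun s => B + N * K * Rpower (2 - s - r) (- (gamma + 1))) 0 1
  (minus (F 1) (F 0))).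
{ apply (is_RInt_derive (V := R_CompleteNormedModule) F); intros s; rewrite Rmin_left, Rmax_right by lra; intros Hs.
  - unfold F, Rpower. auto_derive; [lra|].
    replace (- (gamma + 1) * ln (2 - s - r)) with (- gamma * ln (2 - s - r) + - ln (2 - s - r)) by ring.
    rewrite exp_plus, exp_Ropp, exp_ln by lra. unfold Rminus. field. split; lra.
  - apply (ex_derive_continuous (K := R_AbsRing) (V := R_NormedModule)). unfold Rpower. auto_derive. lra. }
assert (HI := RInt_correct (V := C_R_CompleteNormedModule) _ _ _ (exRInt_ray h z Hh Hz)).
unfold ray_mean. rewrite <- norm_Cmod.
eapply Rle_trans; [apply (norm_RInt_le (V := C_R_NormedModule) _ _ 0 1 _ _ Rle_0_1) with (2 := HI) (3 := HF)|].
- intros s Hs. rewrite norm_Cmod.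
  eapply Rle_trans; [apply H; now apply ray_shrinks|]. apply Rplus_le_compat_l.
  rewrite Rmult_assoc. apply Rmult_le_compat_l; [easy|].
  rewrite Cmod_mult, Cmod_R, Rabs_pos_eq by lra. fold r.
  apply Rle_trans with (Rpower ((2 - s - r) / 2) (- (gamma + 1))).
  + apply Rpower_neg_le; [|lra]. split; [lra|]. nra.
  + right. unfold K, Rpower. rewrite ln_div by lra. rewrite <- exp_plus. f_equal. ring.
(* [F 1] is the claimed bound, and [F 0] is nonnegative and dropped. *)
- unfold F, minus, plus, opp; simpl.
  replace (2 - 1 - r) with (1 - r) by ring.
  assert (P := Rpower_pos (2 - 0 - r) (- gamma)).
  assert (Q : 0 <= N * K / gamma).
  { apply Rmult_le_pos; [nra|apply Rlt_le, Rinv_0_lt_compat; easy]. }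
  replace (K / gamma * N) with (N * K / gamma) by (field; lra). nra.
Qed.

(* Cauchy's bound on the disk of radius [(1 - |z|) / 2]. *)
Lemma derivative_weight_bound F z d gamma N : 0 < gamma -> analytic_on_disk F -> in_disk z ->
  cder F z d ->
  (forall w, Cmod (w - z) <= (1 - Cmod z) / 2 -> growth_weight gamma F w <= N) ->
  Cmod d <= 4 * Rpower 2 gamma * N * Rpower (1 - Cmod z) (- (gamma + 1)).
Proof.
intros Hg HF Hz Hd HN. unfold in_disk in Hz. assert (Z0 := Cmod_ge_0 z).
assert (N0 : 0 <= N).
{ eapply Rle_trans; [apply (growth_weight_ge_0 gamma F z)|]. apply HN.
  replace (z - z)%C with (RtoC 0) by ring. rewrite Cmod_0. lra. }
(* On this disk [1 - |w|] is at least [(1 - |z|) / 2], whence the factor [2 ^ gamma]. The 4 combines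
   the 2 of Cauchy's bound with the halved radius. *)
assert (H : Cmod d <= 2 * (N * Rpower ((1 - Cmod z) / 2) (- gamma)) / ((1 - Cmod z) / 2)).
{ apply (cauchy_derivative_bound F z); [lra| |easy|].
  - intros w Hw. apply HF. unfold in_disk.
    assert (S1 := small_disk z w _ (Rle_refl _) Hw). lra.
  - intros w Hw. assert (S1 := small_disk z w _ (Rle_refl _) Hw).
    eapply Rle_trans; [apply growth_weight_le_iff, HN, Hw|]. apply Rmult_le_compat_l; [easy|].
    apply Rpower_neg_le; lra. }
eapply Rle_trans; [exact H|]. right.
unfold Rpower. rewrite ln_div by lra.
replace (- (gamma + 1) * ln (1 - Cmod z)) with (- gamma * ln (1 - Cmod z) + - ln (1 - Cmod z)) by ring.
replace (- gamma * (ln (1 - Cmod z) - ln 2)) with (gamma * ln 2 + - gamma * ln (1 - Cmod z)) by ring.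
rewrite !exp_plus, exp_Ropp, exp_ln by lra. field. lra.
Qed.

Lemma cesaro_kernel_le t f z : 0 <= t < 1 -> in_disk z ->
  Cmod (cesaro_kernel t f z) <= / (1 - t) * Cmod (f z).
Proof.
intros Ht Hz. unfold cesaro_kernel. rewrite Cmod_div by now apply one_minus_tz_neq_0.
rewrite Rmult_comm. apply Rmult_le_compat_l; [apply Cmod_ge_0|].
apply Rinv_le_contravar; [lra|]. now apply one_minus_tz_bounds.
Qed.

Lemma cesaro_kernel_ge t f z : 0 <= t < 1 -> in_disk z ->
  Cmod (f z) <= 2 * Cmod (cesaro_kernel t f z).
Proof.
intros Ht Hz. assert (B := one_minus_tz_bounds t z Ht Hz).
unfold cesaro_kernel. rewrite Cmod_div by now apply one_minus_tz_neq_0.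
set (m := Cmod (RtoC 1 - RtoC t * z)) in *. assert (P := Cmod_ge_0 (f z)).
apply Rmult_le_reg_r with m; [lra|]. replace (2 * (Cmod (f z) / m) * m) with (2 * Cmod (f z)) by (field; lra). nra.
Qed.

Lemma CInt0_le_ray_mean h z : in_disk z -> Cmod (CInt0 h z) <= Cmod (ray_mean h z).
Proof.
unfold in_disk. intros Hz. rewrite CInt0_ray_mean, Cmod_mult. assert (P := Cmod_ge_0 (ray_mean h z)). nra.
Qed.

Lemma growth_weight_mono a f g z : Cmod (f z) <= Cmod (g z) -> growth_weight a f z <= growth_weight a g z.
Proof. intros H. apply Rmult_le_compat_l; [apply Rlt_le, Rpower_pos|easy]. Qed.

(** The constant of [ray_mean_bound] times the bound [/ (1 - t)] for the factor relating [f] to its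
    kernel. *)
Definition mean_const (t gamma : R) : R := Rpower 2 (gamma + 1) / gamma * / (1 - t).
(** The constant of [derivative_weight_bound] times the upper bound 2 for [|1 - t z|]. *)
Definition diff_const (gamma : R) : R := 2 * (4 * Rpower 2 gamma).

Lemma mean_const_pos t gamma : 0 <= t < 1 -> 0 < gamma -> 0 < mean_const t gamma.
Proof.
intros Ht Hg. apply Rmult_lt_0_compat; [|apply Rinv_0_lt_compat; lra].
apply Rdiv_lt_0_compat; [apply Rpower_pos|easy].
Qed.

Lemma diff_const_pos gamma : 0 < diff_const gamma.
Proof. unfold diff_const. assert (H := Rpower_pos 2 gamma). lra. Qed.

Lemma Ces_weight_bound t gamma f z B N : 0 <= t < 1 -> 0 < gamma -> analytic_on_disk f -> in_disk z ->
  0 <= B -> 0 <= N ->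
  (forall w, Cmod w <= Cmod z -> Cmod (f w) <= B + N * Rpower (1 - Cmod w) (- (gamma + 1))) ->
  growth_weight gamma (Ces t f) z <= / (1 - t) * B * Rpower (1 - Cmod z) gamma + mean_const t gamma * N.
Proof.
intros Ht Hg Hf Hz HB HN H. assert (Hz' := Hz). unfold in_disk in Hz'.
assert (i0 : 0 < / (1 - t)) by (apply Rinv_0_lt_compat; lra).
unfold growth_weight. rewrite Ces_ray_mean.
assert (K := ray_mean_bound (cesaro_kernel t f) z gamma (/ (1 - t) * B) (/ (1 - t) * N) Hg
  (analytic_cesaro_kernel t f Ht Hf) Hz ltac:(nra) ltac:(nra)).
assert (P := Rpower_pos (1 - Cmod z) gamma).
eapply Rle_trans; [apply Rmult_le_compat_l; [lra|apply K]|].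
- intros w Hw. eapply Rle_trans; [apply cesaro_kernel_le; [easy|unfold in_disk; lra]|].
  rewrite Rmult_assoc, <- Rmult_plus_distr_l. apply Rmult_le_compat_l; [lra|now apply H].
- right. rewrite Rpower_Ropp. unfold mean_const. field. repeat split; lra.
Qed.

Lemma CInt0_weight_bound t gamma f z N : 0 <= t < 1 -> 0 < gamma -> analytic_on_disk f -> in_disk z ->
  (forall w, Cmod (w - z) <= (1 - Cmod z) / 2 -> growth_weight gamma (CInt0 (cesaro_kernel t f)) w <= N) ->
  growth_weight (gamma + 1) f z <= diff_const gamma * N.
Proof.
intros Ht Hg Hf Hz HN. assert (Hk := analytic_cesaro_kernel t f Ht Hf).
apply growth_weight_le_iff. eapply Rle_trans; [now apply (cesaro_kernel_ge t)|].
assert (D := derivative_weight_bound _ z _ gamma N Hg (CInt0_analytic _ Hk) Hz (CInt0_cder _ z Hk Hz) HN).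
unfold diff_const. lra.
Qed.

(** * The Volterra operator and the optimal domains *)

(** The integrand is the derivative of the logarithm of [1 - s * u], with real and imaginary parts
    the derivatives of [F1] and [F2]. As [1 - s * u] has positive real part, the path stays in the
    first branch of [Carg]. *)
Lemma CLog_is_RInt u : in_disk u ->
  is_RInt (V := C_R_NormedModule) (fun s => - u * / (RtoC 1 - RtoC s * u))%C 0 1
    (CLog (RtoC 1 - u)).
Proof.
intros Hu. unfold in_disk in Hu. destruct u as [x y].
assert (Hx := Rabs_fst_Cmod (x, y)). simpl in Hx.
assert (Hx1 : -1 < x < 1) by (apply Rabs_lt_between; lra).
assert (Ha : forall s, 0 <= s <= 1 -> 0 < 1 - s * x) by (intros; nra).
unfold CLog.
set (F1 := fun s => ln ((1 - s * x) * (1 - s * x) + (s * y) * (s * y)) / 2).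
set (F2 := fun s => atan (- (s * y) / (1 - s * x))).
assert (H1 : is_RInt (V := R_NormedModule)
  (fun s => (- x * (1 - s * x) + y * (s * y)) / ((1 - s * x) * (1 - s * x) + (s * y) * (s * y)))
  0 1 (minus (F1 1) (F1 0))).
{ apply (is_RInt_derive (V := R_CompleteNormedModule) F1); intros s; rewrite Rmin_left, Rmax_right by lra; intros Hs;
    specialize (Ha s Hs); assert (D : 0 < (1 - s * x) * (1 - s * x) + s * y * (s * y)) by nra.
  - unfold F1. auto_derive; [lra|]. unfold Rminus in *. field. lra.
  - apply (ex_derive_continuous (K := R_AbsRing) (V := R_NormedModule)). auto_derive. lra. }
assert (H2 : is_RInt (V := R_NormedModule)
  (fun s => (- y * (1 - s * x) - x * (s * y)) / ((1 - s * x) * (1 - s * x) + (s * y) * (s * y)))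
  0 1 (minus (F2 1) (F2 0))).
{ apply (is_RInt_derive (V := R_CompleteNormedModule) F2); intros s; rewrite Rmin_left, Rmax_right by lra; intros Hs;
    specialize (Ha s Hs); assert (D : 0 < (1 - s * x) * (1 - s * x) + s * y * (s * y)) by nra.
  - unfold F2. auto_derive; [lra|]. unfold Rminus, Rsqr in *. field. repeat split; nra.
  - apply (ex_derive_continuous (K := R_AbsRing) (V := R_NormedModule)). auto_derive. lra. }
assert (E1 : minus (F1 1) (F1 0) = ln (Cmod (RtoC 1 - (x, y)))).
{ unfold F1, minus, plus, opp; simpl. rewrite !Rmult_0_l, !Rmult_1_l, !Rminus_0_r, Rplus_0_r, !Rmult_1_l, ln_1.
  specialize (Ha 1 ltac:(lra)).
  assert (M0 : 0 < Cmod (RtoC 1 - (x, y))).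
  { eapply Rlt_le_trans; [|apply Rabs_fst_Cmod]. simpl. apply Rabs_pos_lt. lra. }
  replace ((1 - x) * (1 - x) + y * y) with (Cmod (RtoC 1 - (x, y)) * Cmod (RtoC 1 - (x, y))).
  - rewrite ln_mult by easy. field.
  - unfold Cmod. rewrite sqrt_sqrt; simpl; nra. }
assert (E2 : minus (F2 1) (F2 0) = Carg (RtoC 1 - (x, y))).
{ unfold Carg. specialize (Ha 1 ltac:(lra)). simpl.
  destruct (Rlt_dec 0 (1 + - x)) as [_|N]; [|exfalso; lra].
  unfold F2, minus, plus, opp; simpl.
  replace (- (0 * y) / (1 - 0 * x)) with 0 by field. rewrite atan_0, Ropp_0, Rplus_0_r.
  f_equal. unfold Rminus. f_equal; [ring|f_equal; ring]. }
rewrite <- E1, <- E2.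
apply (is_RInt_fct_extend_pair (U := R_NormedModule) (V := R_NormedModule)); simpl.
- apply (is_RInt_ext (V := R_NormedModule)) with (2 := H1). intros s Hs.
  rewrite Rmin_left, Rmax_right in Hs by lra. specialize (Ha s ltac:(lra)).
  assert (D : 0 < (1 - s * x) * (1 - s * x) + s * y * (s * y)) by nra.
  unfold Rminus in *. simpl. field. repeat split; nra.
- apply (is_RInt_ext (V := R_NormedModule)) with (2 := H2). intros s Hs.
  rewrite Rmin_left, Rmax_right in Hs by lra. specialize (Ha s ltac:(lra)).
  assert (D : 0 < (1 - s * x) * (1 - s * x) + s * y * (s * y)) by nra.
  unfold Rminus in *. simpl. field. repeat split; nra.
Qed.

Lemma CLog_CInt0 c z : in_disk (c * z)%C ->
  ex_RIntC (fun s => / (RtoC 1 - c * (RtoC s * z)))%C 0 1 ->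
  CLog (RtoC 1 - c * z) = (- c * CInt0 (fun xi => / (RtoC 1 - c * xi)) z)%C.
Proof.
intros Hz Hex. rewrite <- (is_RInt_unique (V := C_R_CompleteNormedModule) _ _ _ _ (CLog_is_RInt _ Hz)).
rewrite CInt0_ray_mean. unfold ray_mean.
replace (- c * (z * RIntC (fun s => / (RtoC 1 - c * (RtoC s * z))) 0 1))%C
  with (- (c * z) * RIntC (fun s => / (RtoC 1 - c * (RtoC s * z))) 0 1)%C by ring.
rewrite <- RIntC_scal by easy.
apply RIntC_ext; [lra|]. intros s _. do 3 f_equal. ring.
Qed.

Lemma analytic_inv_one_minus c : Cmod c <= 1 -> analytic_on_disk (fun z => / (RtoC 1 - c * z))%C.
Proof.
intros Hc. apply analytic_inv; [apply analytic_affine|]. intros z Hz. unfold in_disk in Hz.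
apply Cmod_gt_0. assert (T := Cmod_triangle (RtoC 1 - c * z) (c * z)).
replace (RtoC 1 - c * z + c * z)%C with (RtoC 1) in T by ring.
rewrite Cmod_1, Cmod_mult in T. assert (Z := Cmod_ge_0 z). assert (Z' := Cmod_ge_0 c). nra.
Qed.

(** Exhibits the principal logarithm as a primitive, hence as analytic. It is taken at [c = t] for
    [g_ t] and at the boundary value [c = 1] for the power singularity. *)
Lemma CLog_one_minus c z : Cmod c <= 1 -> in_disk z ->
  CLog (RtoC 1 - c * z) = (- c * CInt0 (fun xi => / (RtoC 1 - c * xi)) z)%C.
Proof.
intros Hc Hz. apply CLog_CInt0.
- unfold in_disk in *. rewrite Cmod_mult. assert (Z := Cmod_ge_0 z). assert (Z' := Cmod_ge_0 c). nra.
- exact (exRInt_ray _ z (analytic_inv_one_minus c Hc) Hz).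
Qed.

(** Near [z], [g_ t] coincides with the primitive of [1 / (1 - t xi)] vanishing at 0; for [t = 0]
    this primitive is the identity, in accordance with the separate case in [g_]. *)
Lemma C_derive_g t z : 0 <= t < 1 -> in_disk z ->
  C_derive (g_ t) z = (/ (RtoC 1 - RtoC t * z))%C.
Proof.
intros Ht Hz. apply cder_C_derive. unfold in_disk in Hz.
assert (Hd : forall w, Cmod (w - z) < 1 - Cmod z -> in_disk w).
{ intros w Hw. unfold in_disk. assert (T := Cmod_triangle (w - z) z).
  replace (w - z + z)%C with w in T by ring. lra. }
assert (Hc : Cmod (RtoC t) <= 1) by (rewrite Cmod_R, Rabs_pos_eq; lra).
apply (cder_ext_near (CInt0 (fun xi => / (RtoC 1 - RtoC t * xi))%C)) with (r := 1 - Cmod z); [lra| |].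
- intros w Hw. specialize (Hd w Hw). unfold g_. destruct (Req_dec_T t 0) as [->|Hn].
  + rewrite CInt0_ray_mean. unfold ray_mean.
    rewrite (RIntC_ext _ (fun _ => RtoC 1)) by (lra || (intros; field)).
    unfold RIntC. rewrite RInt_const, scal_R_Cmult. replace (1 - 0) with 1 by ring. ring.
  + rewrite CLog_one_minus by easy. field. intros E. apply Hn. now apply RtoC_inj.
- apply (CInt0_cder (fun xi => / (RtoC 1 - RtoC t * xi))%C); [now apply analytic_inv_one_minus|exact Hz].
Qed.

Lemma V_CInt0 t f z : 0 <= t < 1 -> in_disk z -> V (g_ t) f z = CInt0 (cesaro_kernel t f) z.
Proof.
intros Ht Hz. unfold V. rewrite !CInt0_ray_mean. f_equal. apply ray_mean_ext; [easy|].
intros w Hw. now rewrite C_derive_g.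
Qed.

Lemma CInt0_Ces t f z : CInt0 (cesaro_kernel t f) z = (z * Ces t f z)%C.
Proof. now rewrite Ces_ray_mean. Qed.

Lemma V_linear t : 0 <= t < 1 -> disk_linear (V (g_ t)).
Proof.
intros Ht. destruct (Ces_linear t Ht) as [L1 [L2 L3]]. split; [|split].
- intros f g H z Hz. rewrite !V_CInt0, !CInt0_Ces by easy. now rewrite (L1 f g).
- intros f g Hf Hg z Hz. unfold fadd at 2. rewrite !V_CInt0, !CInt0_Ces by easy.
  rewrite (L2 f g) by easy. unfold fadd. ring.
- intros a f Hf z Hz. unfold fscal at 2. rewrite !V_CInt0, !CInt0_Ces by easy.
  rewrite (L3 a f) by easy. unfold fscal. ring.
Qed.

(** Abstracts [V (g_ t)] and [Ces t], which are the two ends of the sandwich: the primitive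
    [CInt0 (cesaro_kernel t f)] equals [V (g_ t) f] on the disk. *)
Definition sandwiched (t : R) (T : (C -> C) -> C -> C) : Prop :=
  disk_linear T /\
  (forall f, analytic_on_disk f -> analytic_on_disk (T f)) /\
  (forall f z, in_disk z ->
     Cmod (CInt0 (cesaro_kernel t f) z) <= Cmod (T f z) <= Cmod (Ces t f z)).

Lemma Ces_sandwiched t : 0 <= t < 1 -> sandwiched t (Ces t).
Proof.
intros Ht. split; [now apply Ces_linear|split].
- intros f Hf. apply (analytic_ext (ray_mean (cesaro_kernel t f))).
  + intros z _. symmetry. apply Ces_ray_mean.
  + now apply ray_mean_analytic, analytic_cesaro_kernel.
- intros f z Hz. split; [|apply Rle_refl]. rewrite Ces_ray_mean. now apply CInt0_le_ray_mean.
Qed.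

Lemma V_sandwiched t : 0 <= t < 1 -> sandwiched t (V (g_ t)).
Proof.
intros Ht. split; [now apply V_linear|split].
- intros f Hf. apply (analytic_ext (CInt0 (cesaro_kernel t f))).
  + intros z Hz. symmetry. now apply V_CInt0.
  + now apply CInt0_analytic, analytic_cesaro_kernel.
- intros f z Hz. rewrite V_CInt0 by easy. split; [apply Rle_refl|].
  rewrite Ces_ray_mean. now apply CInt0_le_ray_mean.
Qed.

Lemma sandwiched_weight_upper t gamma T f z B N : 0 <= t < 1 -> 0 < gamma -> sandwiched t T ->
  analytic_on_disk f -> in_disk z -> 0 <= B -> 0 <= N ->
  (forall w, Cmod w <= Cmod z -> Cmod (f w) <= B + N * Rpower (1 - Cmod w) (- (gamma + 1))) ->
  growth_weight gamma (T f) z <= / (1 - t) * B * Rpower (1 - Cmod z) gamma + mean_const t gamma * N.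
Proof.
intros Ht Hg HT Hf Hz HB HN H. eapply Rle_trans; [|now apply (Ces_weight_bound t gamma f z B N)].
apply growth_weight_mono. now apply (proj2 (proj2 HT) f z).
Qed.

Lemma sandwiched_weight_lower t gamma T f z N : 0 <= t < 1 -> 0 < gamma -> sandwiched t T ->
  analytic_on_disk f -> in_disk z ->
  (forall w, Cmod (w - z) <= (1 - Cmod z) / 2 -> growth_weight gamma (T f) w <= N) ->
  growth_weight (gamma + 1) f z <= diff_const gamma * N.
Proof.
intros Ht Hg HT Hf Hz H. apply (CInt0_weight_bound t); [easy|easy|easy|easy|]. intros w Hw.
eapply Rle_trans; [|apply (H w Hw)]. apply growth_weight_mono. apply (proj2 (proj2 HT) f w).
unfold in_disk in *. assert (S1 := small_disk z w _ (Rle_refl _) Hw). lra.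
Qed.

Lemma sandwiched_norm_upper t gamma T f : 0 <= t < 1 -> 0 < gamma -> sandwiched t T ->
  A (gamma + 1) f ->
  growth_bounded gamma (T f) /\
  growth_norm gamma (T f) <= mean_const t gamma * growth_norm (gamma + 1) f.
Proof.
intros Ht Hg HT [Hf Hb].
assert (H : forall z, in_disk z -> growth_weight gamma (T f) z <= mean_const t gamma * growth_norm (gamma + 1) f).
{ intros z Hz. unfold in_disk in Hz.
  eapply Rle_trans; [apply (sandwiched_weight_upper t gamma T f z 0 (growth_norm (gamma + 1) f));
    [easy|easy|easy|easy|easy|lra|now apply growth_norm_ge_0|]|right; ring].
  intros w Hw. rewrite Rplus_0_l. apply growth_weight_le_iff.
  apply growth_weight_le_norm; [easy|]. unfold in_disk. lra. }
split; [now exists (mean_const t gamma * growth_norm (gamma + 1) f)|now apply growth_norm_le].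
Qed.

Lemma sandwiched_norm_lower t gamma T f : 0 <= t < 1 -> 0 < gamma -> sandwiched t T ->
  analytic_on_disk f -> growth_bounded gamma (T f) ->
  growth_bounded (gamma + 1) f /\
  growth_norm (gamma + 1) f <= diff_const gamma * growth_norm gamma (T f).
Proof.
intros Ht Hg HT Hf Hb.
assert (H : forall z, in_disk z -> growth_weight (gamma + 1) f z <= diff_const gamma * growth_norm gamma (T f)).
{ intros z Hz. apply (sandwiched_weight_lower t gamma T); try easy. intros w Hw.
  apply growth_weight_le_norm; [easy|]. unfold in_disk in *.
  assert (S1 := small_disk z w _ (Rle_refl _) Hw). lra. }
split; [now exists (diff_const gamma * growth_norm gamma (T f))|now apply growth_norm_le].
Qed.

Lemma Rpower_vanish a eps : 0 < a -> 0 < eps ->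
  exists d, 0 < d /\ forall y, 0 < y < d -> Rpower y a < eps.
Proof.
intros Ha He. exists (Rpower eps (/ a)). split; [apply Rpower_pos|]. intros y Hy.
replace eps with (Rpower (Rpower eps (/ a)) a).
- now apply Rlt_Rpower_l.
- rewrite Rpower_mult, Rinv_l, Rpower_1 by lra. easy.
Qed.

(** Inside the radius [1 - d] the function is at most [B], outside it is controlled by the small
    [N], and the sum of the two bounds holds everywhere. The [N] term gives [eps / 2]; the [B] term
    falls below [eps / 2] once [z] is close enough to the boundary. *)
Lemma sandwiched_A0_upper t gamma T f : 0 <= t < 1 -> 0 < gamma -> sandwiched t T ->
  A0 (gamma + 1) f -> A0 gamma (T f).
Proof.
intros Ht Hg HT Hf. destruct Hf as [Hf H]. split; [now apply HT|]. intros eps He.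
assert (K0 := mean_const_pos t gamma Ht Hg).
set (N := eps / (2 * mean_const t gamma)).
assert (N0 : 0 < N) by (apply Rdiv_lt_0_compat; lra).
destruct (H N N0) as [d [d0 Hd]].
destruct (analytic_locally_bounded f (1 - d)) as [M HM]; [lra|easy|].
assert (i0 : 0 < / (1 - t)) by (apply Rinv_0_lt_compat; lra).
set (B := Rabs M). assert (B0 : 0 <= B) by apply Rabs_pos.
destruct (Rpower_vanish gamma (eps / (2 * (/ (1 - t) * B + 1)))) as [e [e0 Hee]]; [easy|apply Rdiv_lt_0_compat; nra|].
exists e. split; [easy|]. intros z [Hz1 Hz2]. specialize (Hee (1 - Cmod z) ltac:(lra)).
eapply Rle_lt_trans; [apply (sandwiched_weight_upper t gamma T f z B N); try easy; [lra|]|].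
- intros w Hw. assert (P := Rpower_pos (1 - Cmod w) (- (gamma + 1))).
  destruct (Rle_lt_dec (Cmod w) (1 - d)) as [L|L].
  + specialize (HM w L). assert (Q := Rle_abs M). fold B in Q. nra.
  + specialize (Hd w ltac:(lra)). apply Rlt_le, growth_weight_le_iff in Hd. lra.
- replace (mean_const t gamma * N) with (eps / 2) by (unfold N; field; lra).
  assert (P := Rpower_pos (1 - Cmod z) gamma).
  set (c := / (1 - t) * B) in *. assert (c0 : 0 <= c) by (unfold c; nra).
  apply Rmult_lt_compat_l with (r := c + 1) in Hee; [|lra].
  replace ((c + 1) * (eps / (2 * (c + 1)))) with (eps / 2) in Hee by (field; lra). nra.
Qed.

Lemma sandwiched_A0_lower t gamma T f : 0 <= t < 1 -> 0 < gamma -> sandwiched t T ->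
  analytic_on_disk f -> A0 gamma (T f) -> A0 (gamma + 1) f.
Proof.
intros Ht Hg HT Hf [_ H]. split; [easy|]. intros eps He. assert (K0 := diff_const_pos gamma).
destruct (H (eps / (2 * diff_const gamma))) as [d [d0 Hd]]; [apply Rdiv_lt_0_compat; lra|].
(* If [|z| > 1 - d / 2], the disk of radius [(1 - |z|) / 2] about [z] stays in the annulus
   [|w| > 1 - d]. *)
exists (d / 2). split; [lra|]. intros z [Hz1 Hz2].
apply Rle_lt_trans with (diff_const gamma * (eps / (2 * diff_const gamma))).
- apply (sandwiched_weight_lower t gamma T); try easy. intros w Hw. apply Rlt_le, Hd.
  assert (S1 := small_disk z w _ (Rle_refl _) Hw).
  assert (S2 := Cmod_triangle w (- (w - z))). replace (w + - (w - z))%C with z in S2 by ring.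
  rewrite Cmod_opp in S2. lra.
- replace (diff_const gamma * (eps / (2 * diff_const gamma))) with (eps / 2) by (field; lra). lra.
Qed.

Lemma sandwiched_optimal_A t gamma T : 0 <= t < 1 -> 0 < gamma -> sandwiched t T ->
  banach_eq (optimal_domain T (A gamma)) (A (gamma + 1)).
Proof.
intros Ht Hg HT.
apply (optimal_domain_banach_eq T _ _ (mean_const t gamma) (diff_const gamma));
  [apply A_linear|apply A_banach; lra|apply growth_norm_ext|apply A_banach; lra|apply HT| |
   now apply mean_const_pos|apply diff_const_pos| |].
- intros f. split.
  + intros [Hf [_ Hb]]. split; [easy|now apply (sandwiched_norm_lower t gamma T)].
  + intros Hf. split; [apply Hf|]. split; [apply HT, Hf|now apply (sandwiched_norm_upper t gamma T)].
- intros f Hf. now apply (sandwiched_norm_upper t gamma T).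
- intros f Hf. apply (sandwiched_norm_lower t gamma T f Ht Hg HT); [apply Hf|now apply (sandwiched_norm_upper t gamma T)].
Qed.

Lemma sandwiched_optimal_A0 t gamma T : 0 <= t < 1 -> 0 < gamma -> sandwiched t T ->
  banach_eq (optimal_domain T (A0 gamma)) (A0 (gamma + 1)).
Proof.
intros Ht Hg HT.
apply (optimal_domain_banach_eq T _ _ (mean_const t gamma) (diff_const gamma));
  [apply A0_linear|apply A0_banach; lra|apply growth_norm_ext|apply A0_banach; lra|apply HT| |
   now apply mean_const_pos|apply diff_const_pos| |].
- intros f. split.
  + intros [Hf Hb]. now apply (sandwiched_A0_lower t gamma T).
  + intros Hf. split; [apply Hf|now apply (sandwiched_A0_upper t gamma T)].
- intros f Hf. apply (sandwiched_norm_upper t gamma T f Ht Hg HT). apply A0_incl_A; [lra|easy].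
- intros f Hf. apply (sandwiched_norm_lower t gamma T f Ht Hg HT); [apply Hf|].
  apply (sandwiched_norm_upper t gamma T f Ht Hg HT), A0_incl_A; [lra|easy].
Qed.

(** * Properness of the inclusion *)

(** The additional factor [1 - |z|] tends to 0 and multiplies a bounded quantity. *)
Lemma A_incl_A0_succ gamma f : A gamma f -> A0 (gamma + 1) f.
Proof.
intros [Hf [M HM]]. split; [easy|]. intros eps He. assert (M0 := Rabs_pos M). assert (M1 := Rle_abs M).
exists (eps / (1 + Rabs M)). split; [apply Rdiv_lt_0_compat; lra|]. intros z [Hz1 Hz2].
specialize (HM z Hz2). unfold growth_weight in *.
rewrite Rpower_plus, Rpower_1 by lra.
assert (P := Rpower_pos (1 - Cmod z) gamma). assert (Q := Cmod_ge_0 (f z)).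
replace (Rpower (1 - Cmod z) gamma * (1 - Cmod z) * Cmod (f z))
  with ((1 - Cmod z) * (Rpower (1 - Cmod z) gamma * Cmod (f z))) by ring.
set (W := Rpower (1 - Cmod z) gamma * Cmod (f z)) in *.
apply Rle_lt_trans with ((1 - Cmod z) * (1 + Rabs M)).
- apply Rmult_le_compat_l; lra.
- replace eps with (eps / (1 + Rabs M) * (1 + Rabs M)) by (field; lra).
  apply Rmult_lt_compat_r; lra.
Qed.

(** The branch of [(1 - z) ^ (- b)]. *)
Definition power_singularity (b : R) (z : C) : C := cexp (- RtoC b * CLog (RtoC 1 - z))%C.

Lemma Cmod_power_singularity b z : Cmod (power_singularity b z) = Rpower (Cmod (RtoC 1 - z)) (- b).
Proof.
unfold power_singularity. rewrite Cmod_cexp. unfold Rpower, CLog. f_equal. simpl. ring.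
Qed.

Lemma analytic_power_singularity b : analytic_on_disk (power_singularity b).
Proof.
assert (H1 : Cmod (RtoC 1) <= 1) by (rewrite Cmod_1; lra).
apply (analytic_ext (fun z => cexp (RtoC b * CInt0 (fun xi => / (RtoC 1 - RtoC 1 * xi))%C z)%C)).
- intros z Hz. unfold power_singularity. f_equal.
  replace z with (RtoC 1 * z)%C at 2 by ring. rewrite CLog_one_minus by easy. ring.
- intros z Hz. eexists. apply (cder_comp cexp (fun z => RtoC b * CInt0 (fun xi => / (RtoC 1 - RtoC 1 * xi))%C z)%C).
  + apply cder_cexp.
  + apply (cder_mult (fun _ => RtoC b)); [apply cder_const|].
    apply (CInt0_cder (fun xi => / (RtoC 1 - RtoC 1 * xi))%C); [now apply analytic_inv_one_minus|easy].
Qed.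

(** Since [|1 - z| >= 1 - |z|], the weighted modulus is at most [(1 - |z|) ^ (gamma - b)], a
    positive power. *)
Lemma power_singularity_in_A0 gamma b : 0 < b < gamma -> A0 gamma (power_singularity b).
Proof.
intros Hb. split; [apply analytic_power_singularity|]. intros eps He.
destruct (Rpower_vanish (gamma - b) eps ltac:(lra) He) as [d [d0 Hd]].
exists d. split; [easy|]. intros z [Hz1 Hz2].
apply Rle_lt_trans with (Rpower (1 - Cmod z) (gamma - b)); [|apply Hd; lra].
unfold growth_weight. rewrite Cmod_power_singularity.
unfold Rminus at 3. rewrite Rpower_plus. apply Rmult_le_compat_l; [apply Rlt_le, Rpower_pos|].
apply Rpower_neg_le; [|lra]. split; [lra|].
assert (T := Cmod_triangle (RtoC 1 - z) z). replace (RtoC 1 - z + z)%C with (RtoC 1) in T by ring.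
rewrite Cmod_1 in T. lra.
Qed.

(** At the real points [1 - y] the inequality [|1 - z| >= 1 - |z|] is an equality, so the weighted
    modulus is exactly [y ^ (gamma - b)], which is unbounded as [y] tends to 0. *)
Lemma power_singularity_notin_A gamma b : gamma < b -> ~ A gamma (power_singularity b).
Proof.
intros Hb [_ [M HM]].
destruct (Rpower_vanish (b - gamma) (/ (1 + Rabs M))) as [d [d0 Hd]];
  [lra|apply Rinv_0_lt_compat; assert (P := Rabs_pos M); lra|].
set (y := Rmin (d / 2) (1 / 2)).
assert (Y1 := Rmin_l (d / 2) (1 / 2)). assert (Y2 := Rmin_r (d / 2) (1 / 2)). fold y in Y1, Y2.
assert (y0 : 0 < y) by (apply Rmin_glb_lt; lra).
specialize (Hd y ltac:(lra)).
assert (Hx : Cmod (RtoC (1 - y)) = 1 - y) by (rewrite Cmod_R, Rabs_pos_eq; lra).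
specialize (HM (RtoC (1 - y)) ltac:(unfold in_disk; lra)).
unfold growth_weight in HM. rewrite Cmod_power_singularity, Hx in HM.
replace (RtoC 1 - RtoC (1 - y))%C with (RtoC y) in HM by (rewrite RtoC_minus; ring).
rewrite Cmod_R, Rabs_pos_eq in HM by lra.
replace (1 - (1 - y)) with y in HM by ring. rewrite <- Rpower_plus in HM.
replace (gamma + - b) with (- (b - gamma)) in HM by ring. rewrite Rpower_Ropp in HM.
assert (P := Rpower_pos y (b - gamma)). assert (Q := Rle_abs M). assert (Q0 := Rabs_pos M).
apply Rinv_lt_contravar in Hd; [|apply Rmult_lt_0_compat; [easy|apply Rinv_0_lt_compat; lra]].
rewrite Rinv_inv in Hd. lra.
Qed.

Theorem proposition4p4 :
  forall (t gamma : R), 0 <= t < 1 -> 0 < gamma ->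
    (* (i) *)
    ((banach_eq (optimal_domain (V (g_ t)) (A gamma))
                (optimal_domain (Ces t) (A gamma)) /\
      banach_eq (optimal_domain (Ces t) (A gamma)) (A (gamma + 1))) /\
     (banach_eq (optimal_domain (V (g_ t)) (A0 gamma))
                (optimal_domain (Ces t) (A0 gamma)) /\
      banach_eq (optimal_domain (Ces t) (A0 gamma)) (A0 (gamma + 1)))) /\
    (* (ii) *)
    (proper_subspace (A gamma) (optimal_domain (Ces t) (A0 gamma)) /\
     banach_eq (optimal_domain (Ces t) (A0 gamma)) (A0 (gamma + 1))).
Proof.
intros t gamma Ht Hg.
assert (SC := Ces_sandwiched t Ht). assert (SV := V_sandwiched t Ht).
assert (C1 := sandwiched_optimal_A t gamma _ Ht Hg SC).
assert (C2 := sandwiched_optimal_A0 t gamma _ Ht Hg SC).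
assert (V1 := sandwiched_optimal_A t gamma _ Ht Hg SV).
assert (V2 := sandwiched_optimal_A0 t gamma _ Ht Hg SV).
split; [split; split|split]; try assumption.
(* The two optimal domains are compared through the growth space that both equal. *)
- exact (banach_eq_trans _ _ _ V1 (banach_eq_sym _ _ C1)).
- exact (banach_eq_trans _ _ _ V2 (banach_eq_sym _ _ C2)).
- assert (E := proj1 (proj2 (proj2 C2))).
  split; [apply A_linear|split; [apply C2|split]].
  + intros f Hf. apply (proj2 (E f)). now apply A_incl_A0_succ.
  (* The exponent lies strictly between [gamma] and [gamma + 1], as the two lemmas on the
     singularity require. *)
  + exists (power_singularity (gamma + 1 / 2)). split.
    * apply (proj2 (E _)). apply power_singularity_in_A0. lra.
    * apply power_singularity_notin_A. lra.
Qed.
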